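(* Let $p$ be a prime and let $G_1$ and $G_2$ be non-trivial pro-$p$ groups. There exists a homomorphism $\theta: G_1 \times G_2 \to 1 + p\mathbb{Z}_p$ (with $\mathrm{Im}(\theta) \leq 1 + 4\mathbb{Z}_2$ if $p=2$) such that $(G_1 \times G_2, \theta)$ is a $1$-smooth cyclotomic pro-$p$ pair if and only if one of the groups $G_1$ or $G_2$ is torsion-free abelian and the other one is absolutely torsion-free, in which case $\theta$ must be the trivial homomorphism (that is, any such $\theta$ making the pair $1$-smooth is trivial).
   Context: Conventions: subgroups of pro-$p$ groups are closed and homomorphisms are continuous. A pro-$p$ group $G$ is absolutely torsion-free if for every closed subgroup $H$ of $G$ the abelianization $H^{ab}=H/[H,H]$ (with $[H,H]$ the closed commutator subgroup) is torsion-free. A cyclotomic pro-$p$ pair is a pair $(G,\theta)$ consisting of a pro-$p$ group $G$ and a continuous homomorphism $\theta:G\to 1+p\mathbb{Z}_p$, where $1+p\mathbb{Z}_p$ is regarded as a subgroup of the multiplicative group $\mathbb{Z}_p^{\times}$. Let $\mathbb{Z}_p(1)$ denote the $G$-module whose underlying group is $\mathbb{Z}_p$ with action $g\cdot v=\theta(g)v$ for $g \in G$, $v\in\mathbb{Z}_p$. The pair $(G,\theta)$ is $1$-smooth if for every open subgroup $U$ of $G$ and every integer $n\ge 1$, the map on continuous cohomology $H^1(U,\mathbb{Z}_p(1)/p^n\mathbb{Z}_p(1))\to H^1(U,\mathbb{Z}_p(1)/p\mathbb{Z}_p(1))$ induced by reduction modulo $p$ is surjective (equivalently, the same holds for every closed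 subgroup). *)

(* Defs.v *)
From HB Require Import structures.
From mathcomp Require Import all_boot all_order all_algebra.
From mathcomp Require Import boolp classical_sets functions cardinality.
From mathcomp Require Import topology.
Set Implicit Arguments.
Unset Strict Implicit.
Unset Printing Implicit Defensive.
Import GRing.Theory.
Local Open Scope classical_set_scope.
Local Open Scope ring_scope.
Local Open Scope quotient_scope.

HB.mixin Record isTopologicalGroup G & Topological G & Group G := {
  mulg_continuous : continuous (fun x : G * G => (x.1 * x.2)%g);
  invg_continuous : continuous (fun x : G => (x^-1)%g)
}.

#[short(type="topologicalGroupType")]
HB.structure Definition TopologicalGroup :=
  {G of Topological G & Group G & isTopologicalGroup G}.

Section ProductTopologicalGroup.
Variables G H : topologicalGroupType.

Let continuous_pair (S T T' : topologicalType) (f : S -> T) (g : S -> T') :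
  continuous f -> continuous g -> continuous (fun x => (f x, g x)).
Proof. by move=> fc gc x; apply: cvg_pair; [exact: fc|exact: gc]. Qed.

Let fst_continuous (S T : topologicalType) : continuous (@fst S T).
Proof. by move=> x; exact: cvg_fst. Qed.

Let snd_continuous (S T : topologicalType) : continuous (@snd S T).
Proof. by move=> x; exact: cvg_snd. Qed.

Let comp_continuous (S T V : topologicalType) (f : S -> T) (g : T -> V) :
  continuous f -> continuous g -> continuous (g \o f).
Proof. by move=> fc gc x; apply: continuous_comp; [exact: fc|exact: gc]. Qed.

Fact pair_mulg_continuous :
  continuous (fun x : (G * H) * (G * H) => (x.1 * x.2)%g).
Proof.
apply: (@continuous_pair _ _ _
  ((fun v : G * G => (v.1 * v.2)%g) \o (fun u => (u.1.1, u.2.1)))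
  ((fun v : H * H => (v.1 * v.2)%g) \o (fun u => (u.1.2, u.2.2)))).
  apply: comp_continuous mulg_continuous; apply: continuous_pair.
    exact: (comp_continuous (@fst_continuous _ _) (@fst_continuous _ _)).
  exact: (comp_continuous (@snd_continuous _ _) (@fst_continuous _ _)).
apply: comp_continuous mulg_continuous; apply: continuous_pair.
  exact: (comp_continuous (@fst_continuous _ _) (@snd_continuous _ _)).
exact: (comp_continuous (@snd_continuous _ _) (@snd_continuous _ _)).
Qed.

Fact pair_invg_continuous : continuous (fun x : G * H => (x^-1)%g).
Proof.
apply: (@continuous_pair _ _ _
  ((fun v : G => (v^-1)%g) \o fst) ((fun v : H => (v^-1)%g) \o snd)).
  exact: comp_continuous (@fst_continuous _ _) invg_continuous.
exact: comp_continuous (@snd_continuous _ _) invg_continuous.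
Qed.

HB.instance Definition _ := isTopologicalGroup.Build (G * H)%type
  pair_mulg_continuous pair_invg_continuous.

End ProductTopologicalGroup.

Section Groups.
Variable G : topologicalGroupType.
Implicit Types H N U : set G.

Definition is_subgroup H :=
  [/\ H 1%g, (forall x y, H x -> H y -> H (x * y)%g)
    & forall x, H x -> H (x^-1)%g].

Definition is_normal_subgroup N :=
  is_subgroup N /\ forall x y, N x -> N (x ^ y)%g.

Definition lcosets N : set (set G) :=
  [set [set (x * y)%g | y in N] | x in [set: G]].

Definition is_pro_p (p : nat) :=
  [/\ compact [set: G], hausdorff_space G, totally_disconnected [set: G]
    & forall N, open N -> is_normal_subgroup N ->
        exists k : nat, (lcosets N #= `I_(p ^ k))%card].

Definition nontrivial_group := exists x : G, x != 1%g.

Definition torsion_free_abelian :=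
  (forall x y : G, (x * y = y * x)%g) /\
  (forall (x : G) (n : nat), (0 < n)%N -> (x ^+ n = 1)%g -> x = 1%g).

Definition closed_commutator H : set G :=
  closure (smallest is_subgroup [set [~ x, y]%g | x in H & y in H]).

(* (x N) ^+ n is the coset of x ^+ n, and it is trivial iff N (x ^+ n) *)
Definition torsion_free_quotient H N :=
  forall (x : G) (n : nat), H x -> (0 < n)%N -> N (x ^+ n)%g -> N x.

Definition absolutely_torsion_free :=
  forall H, closed H -> is_subgroup H ->
    torsion_free_quotient H (closed_commutator H).

End Groups.
Arguments is_pro_p : clear implicits.
Arguments nontrivial_group : clear implicits.
Arguments torsion_free_abelian : clear implicits.
Arguments absolutely_torsion_free : clear implicits.

Lemma continuous_discreteP (S : topologicalType) (T : choiceType) (c : S -> T) :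
  continuous (c : S -> discrete_topology T) <->
  forall x, \forall y \near x, c y = c x.
Proof.
have E x := @discrete_cvg (discrete_topology T) (c @ x) (c x)
  (fmap_filter _ (nbhs_filter x)).
by split=> cc x; [exact: (E x).1 (cc x)|exact: (E x).2 (cc x)].
Qed.

Section Cohomology.
Variables (G : topologicalGroupType) (U : set G) (M : zmodType).
Variable act : G -> {additive M -> M}.

(* The product in U is expressed by an equation in G, so that U need not carry
   a group structure of its own. *)
Definition is_cocycle (c : U -> M) :=
  continuous (c : U -> discrete_topology M) /\
  forall g h k : U, \val k = (\val g * \val h)%g ->
    c k = c g + act (\val g) (c h).

Definition cocycle_pred : {pred U -> M} := [pred c | `[< is_cocycle c >]].

Fact cocycle_zmod_closed : zmod_closed cocycle_pred.
Proof.
split=> [|c d]; first apply/asboolP; first split.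
- by apply/continuous_discreteP => x; near=> y.
- by move=> g h k _; rewrite /= raddf0 addr0.
move=> /asboolP[/continuous_discreteP cc c1] /asboolP[/continuous_discreteP dc d1].
apply/asboolP; split.
- apply/continuous_discreteP => x; near=> y; rewrite [LHS]/= [RHS]/=.
  by congr (_ - _); near: y; [exact: cc|exact: dc].
- move=> g h k kE; rewrite -[LHS]/(c k - d k) (c1 _ _ _ kE) (d1 _ _ _ kE).
  rewrite -[(c - d) g]/(c g - d g) -[(c - d) h]/(c h - d h) raddfB opprD.
  by rewrite addrACA.
Unshelve. all: by end_near. Qed.

HB.instance Definition _ :=
  GRing.isZmodClosed.Build (U -> M) cocycle_pred cocycle_zmod_closed.

Definition Z1 := {c : U -> M | cocycle_pred c}.

HB.instance Definition _ := [isSub of Z1 for sval].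
HB.instance Definition _ := [Choice of Z1 by <:].
HB.instance Definition _ := [SubChoice_isSubZmodule of Z1 by <:].

Definition coboundary_pred : {pred Z1} :=
  [pred c : Z1 | `[< exists m : M, forall g : U,
                       \val c g = act (\val g) m - m >]].

Fact coboundary_zmod_closed : zmod_closed coboundary_pred.
Proof.
split=> [|c d /asboolP[m mE] /asboolP[m' m'E]]; apply/asboolP.
  by exists 0 => g; rewrite raddf0 subr0.
exists (m - m') => g.
rewrite -[LHS]/(\val c g - \val d g) mE m'E (raddfB (act _)) !opprD.
by rewrite addrACA.
Qed.

HB.instance Definition _ :=
  GRing.isZmodClosed.Build Z1 coboundary_pred coboundary_zmod_closed.

Definition H1 := {ideal_quot coboundary_pred}.

End Cohomology.

Section CohomologyMap.
Variables (G : topologicalGroupType) (U : set G) (M N : zmodType).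
Variables (actM : G -> {additive M -> M}) (actN : G -> {additive N -> N}).
Variable f : {additive M -> N}.
Hypothesis f_equivariant : forall g x, f (actM g x) = actN g (f x).

Fact Z1_map_subproof (c : Z1 U actM) : cocycle_pred actN (f \o \val c).
Proof.
have /asboolP[cc c1] := svalP c; apply/asboolP; split=> /= [x|g h k kE].
  move: x; apply/continuous_discreteP => x; move/continuous_discreteP: cc => /(_ x).
  by apply: filterS => y /= ->.
by rewrite (c1 _ _ _ kE) raddfD f_equivariant.
Qed.

Definition Z1_map (c : Z1 U actM) : Z1 U actN :=
  exist _ (f \o \val c) (Z1_map_subproof c).

Definition H1_map (a : H1 U actM) : H1 U actN :=
  \pi_(H1 U actN) (Z1_map (repr a)).

Lemma H1_map_pi (c : Z1 U actM) : H1_map (\pi_(H1 U actM) c) = \pi_(H1 U actN) (Z1_map c).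
Proof.
rewrite /H1_map; apply/eqP; rewrite -Quotient.idealrBE.
have : repr (\pi_(H1 U actM) c) - c \in @coboundary_pred G U M actM.
  by rewrite Quotient.idealrBE reprK.
case/asboolP => m mE; apply/asboolP; exists (f m) => g.
by rewrite -f_equivariant -raddfB -mE [RHS]raddfB.
Qed.

End CohomologyMap.

Section Padic.
Variable p : nat.

(* Z_p as the inverse limit of the Z / p^n, the latter being represented by
   the integers in [0, p^n[; [p] is meant to be positive. *)
Definition is_padic (x : nat -> int) :=
  forall n, x n = (x n.+1 %% (p ^ n)%N)%Z.

Definition padic := {x : nat -> int | is_padic x}.

HB.instance Definition _ := gen_eqMixin padic.
HB.instance Definition _ := gen_choiceMixin padic.

Definition digits (x : padic) : prod_topology (fun _ : nat => discrete_topology int) :=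
  sval x.

HB.instance Definition _ :=
  Topological.copy padic (initial_topology digits).

Implicit Types x y z : padic.

Lemma padic_eq x y : digits x =1 digits y -> x = y.
Proof.
case: x y => [x xP] [y yP] /funext; rewrite /digits /= => xy.
by case: y / xy yP => yP; congr exist; exact: Prop_irrelevance.
Qed.

Let modz_modS (a : int) n :
  ((a %% (p ^ n.+1)%N)%Z %% (p ^ n)%N)%Z = (a %% (p ^ n)%N)%Z.
Proof.
have E : (p ^ n.+1)%N%:Z = p%:Z * (p ^ n)%N%:Z by rewrite expnS PoszM.
by rewrite [in RHS](divz_eq a (p ^ n.+1)%N) [X in _ * X + _]E mulrA modzMDl.
Qed.

Let padicE x n : (digits x n.+1 %% (p ^ n)%N)%Z = digits x n.
Proof. by rewrite /digits -(svalP x). Qed.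

Let padic_mod x n : (digits x n %% (p ^ n)%N)%Z = digits x n.
Proof. by rewrite -padicE modz_mod. Qed.

Fact padic_of_int_subproof (a : int) :
  is_padic (fun n => (a %% (p ^ n)%N)%Z).
Proof. by move=> n; rewrite modz_modS. Qed.
Definition padic_of_int a : padic := exist _ _ (padic_of_int_subproof a).

Fact padic_add_subproof x y :
  is_padic (fun n => ((digits x n + digits y n) %% (p ^ n)%N)%Z).
Proof.
move=> n; rewrite modz_modS -(padicE x) -(padicE y).
by rewrite modzDml modzDmr.
Qed.
Definition padic_add x y : padic := exist _ _ (padic_add_subproof x y).

Fact padic_opp_subproof x : is_padic (fun n => (- digits x n %% (p ^ n)%N)%Z).
Proof. by move=> n; rewrite modz_modS -(padicE x) modzNm. Qed.
Definition padic_opp x : padic := exist _ _ (padic_opp_subproof x).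

Fact padic_mul_subproof x y :
  is_padic (fun n => ((digits x n * digits y n) %% (p ^ n)%N)%Z).
Proof.
move=> n; rewrite modz_modS -(padicE x) -(padicE y).
by rewrite modzMml modzMmr.
Qed.
Definition padic_mul x y : padic := exist _ _ (padic_mul_subproof x y).

Fact padic_addA : associative padic_add.
Proof. by move=> x y z; apply: padic_eq => n /=; rewrite modzDml modzDmr addrA. Qed.

Fact padic_addC : commutative padic_add.
Proof. by move=> x y; apply: padic_eq => n /=; rewrite addrC. Qed.

Fact padic_add0 : left_id (padic_of_int 0) padic_add.
Proof. by move=> x; apply: padic_eq => n /=; rewrite modzDml add0r padic_mod. Qed.

Fact padic_addN : left_inverse (padic_of_int 0) padic_opp padic_add.
Proof. by move=> x; apply: padic_eq => n /=; rewrite modzDml addNr. Qed.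

HB.instance Definition _ :=
  GRing.isZmodule.Build padic padic_addA padic_addC padic_add0 padic_addN.

Fact padic_mulA : associative padic_mul.
Proof. by move=> x y z; apply: padic_eq => n /=; rewrite modzMml modzMmr mulrA. Qed.

Fact padic_mulC : commutative padic_mul.
Proof. by move=> x y; apply: padic_eq => n /=; rewrite mulrC. Qed.

Fact padic_mul1 : left_id (padic_of_int 1) padic_mul.
Proof. by move=> x; apply: padic_eq => n /=; rewrite modzMml mul1r padic_mod. Qed.

Fact padic_mul1r : right_id (padic_of_int 1) padic_mul.
Proof. by move=> x; rewrite padic_mulC padic_mul1. Qed.

Fact padic_mulDl : left_distributive padic_mul +%R.
Proof.
move=> x y z; apply: padic_eq => n /=.
by rewrite modzMml modzDml modzDmr mulrDl.
Qed.

Fact padic_mulDr : right_distributive padic_mul +%R.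
Proof. by move=> x y z; rewrite padic_mulC padic_mulDl !(padic_mulC x). Qed.

HB.instance Definition _ := GRing.Zmodule_isPzRing.Build padic
  padic_mulA padic_mul1 padic_mul1r padic_mulDl padic_mulDr.
HB.instance Definition _ :=
  GRing.PzRing_hasCommutativeMul.Build padic padic_mulC.

End Padic.

Section Twist.
Variable p : nat.

Definition multiples n : {pred padic p} :=
  [pred x | `[< exists y, x = y *+ p ^ n >]].

Fact multiples_zmod_closed n : zmod_closed (multiples n).
Proof.
split=> [|x y /asboolP[a ->] /asboolP[b ->]]; apply/asboolP.
  by exists 0; rewrite mul0rn.
by exists (a - b); rewrite mulrnBl.
Qed.

HB.instance Definition _ n :=
  GRing.isZmodClosed.Build (padic p) (multiples n) (multiples_zmod_closed n).

Definition padic_mod n := {ideal_quot multiples n}.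

Definition scale_mod (a : padic p) n (v : padic_mod n) : padic_mod n :=
  \pi_(padic_mod n) (a * repr v).

Definition red_mod n (v : padic_mod n.+1) : padic_mod 1 :=
  \pi_(padic_mod 1) (repr v).

Let pi_eqP n (x y : padic p) :
  reflect (exists z, x - y = z *+ p ^ n) (\pi_(padic_mod n) x == \pi_(padic_mod n) y).
Proof. by rewrite -Quotient.idealrBE; exact: asboolP. Qed.

Let pi_reprP n (x : padic p) :
  exists z, repr (\pi_(padic_mod n) x) - x = z *+ p ^ n.
Proof. by apply/pi_eqP; rewrite reprK. Qed.

Lemma scale_mod_pi a n x : scale_mod a (\pi_(padic_mod n) x) = \pi_(padic_mod n) (a * x).
Proof.
have [z zE] := pi_reprP n x; apply/eqP/pi_eqP; exists (a * z).
by rewrite -mulrBr zE mulrnAr.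
Qed.

Lemma red_mod_pi n x : red_mod (\pi_(padic_mod n.+1) x) = \pi_(padic_mod 1) x.
Proof.
have [z zE] := pi_reprP n.+1 x; apply/eqP/pi_eqP; exists (z *+ p ^ n).
by rewrite zE -mulrnA -expnD addn1.
Qed.

Fact scale_mod_zmod_morphism a n : zmod_morphism (@scale_mod a n).
Proof.
move=> u v; rewrite -[u]reprK -[v]reprK -raddfB !scale_mod_pi.
by rewrite mulrBr raddfB.
Qed.
HB.instance Definition _ a n :=
  GRing.isZmodMorphism.Build _ _ (@scale_mod a n) (@scale_mod_zmod_morphism a n).

Fact red_mod_zmod_morphism n : zmod_morphism (@red_mod n).
Proof. by move=> u v; rewrite -[u]reprK -[v]reprK -raddfB !red_mod_pi raddfB. Qed.
HB.instance Definition _ n :=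
  GRing.isZmodMorphism.Build _ _ (@red_mod n) (@red_mod_zmod_morphism n).

Fact red_scale_mod a n (v : padic_mod n.+1) :
  red_mod (scale_mod a v) = scale_mod a (red_mod v).
Proof. by rewrite -[v]reprK !(scale_mod_pi, red_mod_pi). Qed.

Variables (G : topologicalGroupType) (theta : G -> padic p).

Definition cyclotomic_pair :=
  [/\ is_pro_p G p, continuous theta,
      (forall g h, theta (g * h)%g = theta g * theta h)
    & forall g, exists z, theta g = 1 + z *+ p].

Definition image_in_1_4Zp := forall g, exists z, theta g = 1 + z *+ 4.

(* The action g . v = theta(g) v of G on Z_p(1) / p^n Z_p(1) *)
Definition twist n (g : G) : {additive padic_mod n -> padic_mod n} :=
  @scale_mod (theta g) n.

(* H^1(U, Z_p(1) / p^(n+1)) -> H^1(U, Z_p(1) / p), reduction modulo p *)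
Definition H1_red (U : set G) n : H1 U (twist n.+1) -> H1 U (twist 1) :=
  @H1_map G U _ _ (twist n.+1) (twist 1) (@red_mod n)
    (fun g => @red_scale_mod (theta g) n).

(* The exponent n >= 1 of the definition is n.+1 here. *)
Definition one_smooth :=
  forall U : set G, open U -> is_subgroup U ->
  forall (n : nat) (b : H1 U (twist 1)),
    exists a : H1 U (twist n.+1), H1_red a = b.

End Twist.

(* Main.v *)
(* Write G = G1 x G2.  Two commuting elements x and y of G that can be told apart
   by a finite p-quotient killing x but not y admit a lift C of a character with
   C x = 0 and C y = 1 mod p; the cocycle identity for xy = yx then reads
   (theta x - 1) C y = (theta y - 1) C x.  Applied to (x, 1) and (1, y), and with
   the roles exchanged, this makes theta x - 1 and theta y - 1 divisible by p more
   often than each other, so both vanish: theta is trivial.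

   For trivial theta, 1-smoothness says that characters U -> Z/p lift to Z/p^n,
   and this is equivalent to absolute torsion-freeness: characters of finite
   abelian quotients extend from subgroups and separate points.

   If [x, y] <> 1 in G1 and [z, w] <> 1 in G2, choose finite quotients in which
   these commutators are central of order p.  In the preimage U of the subgroup
   generated by (x, z), (y, w), ([x, y], 1) and (x^p, 1), the p-th power of
   ([x, y], 1) agrees modulo [U, U] with [(x^p, 1), (y, w)], hence is trivial in
   the abelianization of U, while ([x, y], 1) is not. *)
Require Import Defs.
From mathcomp Require Import all_boot all_order all_algebra all_fingroup all_solvable.
From mathcomp Require Import boolp classical_sets functions cardinality.
From mathcomp Require Import topology.
From mathcomp Require Import ring.
Set Implicit Arguments.
Unset Strict Implicit.
Unset Printing Implicit Defensive.
Import GRing.Theory.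
Local Open Scope classical_set_scope.

(** * Topological groups *)

(** The definition of 1-smoothness speaks of classes of continuous cocycles with values in a
    quotient of [padic p]. All of this is moved to integer-valued functions on G read modulo p ^ n,
    with continuity kept as vanishing near 1. Surjectivity on classes becomes surjectivity on
    cocycles: theta is 1 modulo p, so coboundaries modulo p are zero. A second gap separates open
    subgroups, on which 1-smoothness is tested, from closed ones, on which torsion-freeness is. A
    closed H is replaced by the preimage U of its image in a finite quotient: torsion relations pass
    from H to U, and the obstruction survives in that quotient. Conversely, a lift of a character is
    built in a single finite quotient, which compactness provides. In the last step (x^p, 1) is
    adjoined so that [(x^p, 1), (y, w)] lies in [U, U]. The image of [U, U] lies in the cyclic group
    generated by ([x, y], [z, w]), and its second coordinate, of order p, is what keeps the image of
    ([x, y], 1) out. *)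

(* Points of the intersection Q of the clopen sets around x cannot be
   separated: in a compact Hausdorff space Q is connected. *)
Lemma compact_totally_disconnected_zero_dimensional (T : topologicalType) :
  compact [set: T] -> hausdorff_space T -> totally_disconnected [set: T] ->
  zero_dimensional T.
Proof.
move=> cT hT tdT x y xy; apply: contrapT => noU.
pose Q := \bigcap_(U in [set U : set T | clopen U /\ U x]) U.
have Qx : Q x by move=> U [].
have Qy : Q y.
  by move=> U [cU Ux]; apply: contrapT => Uy; apply: noU; exists U.
have Qcl : closed Q by apply: closed_bigI => U [[]].
suff Qco : connected Q.
  have : connected_component setT x y by exists Q.
  by rewrite tdT // => yx; move: xy; rewrite yx eqxx.
apply/connectedP => E [E0 QE [s1 s2]].
have cE b : closed (E b).
  apply/closure_id/seteqP; split; first exact: subset_closure.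
  move=> z zE; have : Q z.
    rewrite ((closure_id Q).1 Qcl); apply: closureS zE => u Eu.
    by rewrite QE; case: b Eu; [right|left].
  rewrite QE; case: b zE => zE [] // Ez.
  - by have : (E false `&` closure (E true)) z by []; rewrite s2.
  - by have : (closure (E false) `&` E true) z by []; rewrite s1.
have E01 : E false `&` E true = set0.
  by move: s1; rewrite -((closure_id (E false)).1 (cE _)).
have [V [oV EV V0]] : exists V : bool -> set T, [/\ forall b, open (V b),
    forall b, E b `<=` V b & V false `&` V true = set0].
  have [|A /set_nbhsP[U [oU EU UA]] AE] := compact_normal hT cT (cE false) (t := ~` E true).
    apply/set_nbhsP; exists (~` E true); split=> //; first exact: closed_openC.
    exact/disjoints_subset.
  exists (fun b => if b then ~` closure A else U); split.
  - by case=> //; exact/closed_openC/closed_closure.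
  - by case=> // z Ez /AE.
  - by apply/disjoints_subset; rewrite setCK => z /UA; exact: subset_closure.
pose W := V false `|` V true.
(* Otherwise the sets D minus W, for D clopen around x, generate a proper filter. A cluster point of
   it lies in every D, hence in Q and in the open set W, which all these sets miss. *)
have [D [[oD cD] Dx] DW] : exists2 D, clopen D /\ D x & D `<=` W.
  apply: contrapT => noD.
  pose F := filter_from [set D : set T | clopen D /\ D x] (fun D => D `\` W).
  have FF : ProperFilter F.
    apply: filter_from_proper.
      apply: filter_from_filter.
        by exists setT; split=> //; exact: clopenT.
      move=> A B [cA Ax] [cB Bx]; exists (A `&` B); last by move=> z [[? ?] ?].
      by split=> //; exact: clopenI.
    move=> A cA; apply: contrapT => AW; apply: noD; exists A => // z Az.
    by apply: contrapT => Wz; apply: AW; exists z.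
  have [z [_ zF]] := cT F FF filterT.
  have Qz : Q z.
    move=> A [cA Ax]; rewrite ((closure_id A).1 cA.2).
    move=> B Bz; have /(_ B) [||w [[]]] := zF (A `\` W) => //; last by exists w.
    by exists A.
  have : W z by rewrite QE in Qz; case: Qz => /EV; [left|right].
  have oW : open W by exact: openU.
  move=> Wz; have [||w [[_ nW] ?]] := zF (setT `\` W) W => //.
    by exists setT => //; split=> //; exact: clopenT.
  exact: open_nbhs_nbhs.
(* Inside D the complement of [V b] is [V (~~ b)], so the part of D in [V b] is clopen. As it
   contains x, it contains all of Q, including z. *)
have key b z : V b x -> E (~~ b) z -> False.
  move=> Vx Ez.
  have clD : clopen (D `&` V b).
    split; first exact: openI.
    suff -> : D `&` V b = D `&` ~` V (~~ b).
      by apply: closedI => //; exact: open_closedC.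
    apply/seteqP; split=> u [Du].
      move=> Vu; split=> // Vu'.
      have : (V false `&` V true) u by case: (b) Vu Vu'.
      by rewrite V0.
    move=> Vu; split=> //; case: (DW u Du) => Vu'.
      by case: (b) Vu => //= Vu; case: Vu.
    by case: (b) Vu => //= Vu; case: Vu.
  have Qz : Q z by rewrite QE; case: (b) Ez; [left|right].
  have [_ Vz] : (D `&` V b) z by apply: Qz.
  have : (V false `&` V true) z by case: (b) Vz (EV _ _ Ez).
  by rewrite V0.
have : Q x by []; rewrite QE.
by case=> /EV Vx; [have [z /(key _ z Vx)] := E0 true|have [z /(key _ z Vx)] := E0 false].
Qed.

Section TopologicalGroups.
Local Open Scope group_scope.
Variable G : topologicalGroupType.
Implicit Types (x y z g h : G) (H N R U O : set G).

Section Continuity.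
Variable T : topologicalType.
Implicit Types f : T -> G.

Lemma continuousMg f f' :
  continuous f -> continuous f' -> continuous (fun t => f t * f' t).
Proof.
move=> fc fc' t.
apply: (@continuous_comp _ _ _ (fun t => (f t, f' t)) (fun u => u.1 * u.2)).
  by apply: cvg_pair; [exact: fc|exact: fc'].
exact: mulg_continuous.
Qed.

Lemma continuousVg f : continuous f -> continuous (fun t => (f t)^-1).
Proof.
move=> fc t; apply: (@continuous_comp _ _ _ f (fun u => u^-1)); first exact: fc.
exact: invg_continuous.
Qed.

Lemma continuousXg f n : continuous f -> continuous (fun t => f t ^+ n).
Proof.
move=> fc; elim: n => [|n IHn].
  by under eq_fun do rewrite expg0; exact: cst_continuous.
by under eq_fun do rewrite expgS; exact: continuousMg.
Qed.

Lemma continuousJg f f' :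
  continuous f -> continuous f' -> continuous (fun t => f t ^ f' t).
Proof. by move=> fc fc'; do ?[apply: continuousMg|apply: continuousVg]. Qed.

End Continuity.

Lemma continuous_idg : continuous (fun x => x : G).
Proof. by move=> x; exact: cvg_id. Qed.

Lemma subgX H x n : is_subgroup H -> H x -> H (x ^+ n).
Proof.
by move=> [H1 HM _] Hx; elim: n => [|n IHn]; rewrite ?expg0 // expgS; exact: HM.
Qed.

Lemma subgJ H x y : is_subgroup H -> H x -> H y -> H (x ^ y).
Proof. by move=> [_ HM HV] Hx Hy; do ?apply: (HM) => //; exact: HV. Qed.

Lemma subgR H x y : is_subgroup H -> H x -> H y -> H [~ x, y].
Proof. by move=> HH Hx Hy; case: (HH) => _ HM HV; apply: HM; [exact: HV|exact: subgJ]. Qed.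

Lemma subgMl H x y : is_subgroup H -> H x -> H (x * y) -> H y.
Proof. by move=> [_ HM HV] Hx Hxy; rewrite -(mulKg x y); apply: HM => //; exact: HV. Qed.

Lemma nbhs_lmulg x y (A : set G) :
  nbhs (x * y) A -> nbhs y [set z | A (x * z)].
Proof.
by apply: (continuousMg (f := cst x) (f' := id)) => //;
  [exact: cst_continuous|exact: continuous_idg].
Qed.

Lemma subgroup_open H : is_subgroup H -> nbhs 1 H -> open H.
Proof.
move=> HH H1; rewrite openE => x Hx.
have : nbhs x [set z | H (x^-1 * z)] by apply: nbhs_lmulg; rewrite mulVg.
apply: filterS => z /= Hz; case: HH => _ HM _.
by rewrite -(mulKVg x z); exact: HM.
Qed.

Lemma open_subgroup_closed H : is_subgroup H -> open H -> closed H.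
Proof.
move=> HH oH x clHx.
have : nbhs x [set z | H (x^-1 * z)].
  by apply: nbhs_lmulg; rewrite mulVg; apply: open_nbhs_nbhs; split=> //; case: HH.
case/clHx => z [Hz /= Hxz]; case: HH => _ HM HV.
have -> : x = z * (x^-1 * z)^-1 by rewrite invgM invgK mulKVg.
by apply: (HM) => //; exact: HV.
Qed.

Lemma closure_is_subgroup H : is_subgroup H -> is_subgroup (closure H).
Proof.
move=> [H1 HM HV].
split=> [|x y cx cy A xyA|x cx A xA]; first exact: subset_closure.
  have [[B C] /= [xB yC] BC] := @mulg_continuous G (x, y) A xyA.
  have [z [Hz Bz]] := cx B xB; have [w [Hw Cw]] := cy C yC.
  by exists (z * w); split; [exact: HM|exact: (BC (z, w))].
have [z [Hz Az]] := cx _ (@invg_continuous G x A xA).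
by exists z^-1; split=> //; exact: HV.
Qed.

Lemma smallest_is_subgroup (A : set G) : is_subgroup (smallest (@is_subgroup G) A).
Proof.
split=> [B [[B1 _ _] _]|x y Ax Ay B BA|x Ax B BA] //.
  by case: (BA) => -[_ BM _] _; apply: BM; [exact: Ax|exact: Ay].
by case: (BA) => -[_ _ BV] _; apply: BV; exact: Ax.
Qed.

Lemma closed_commutator_subgroup H : is_subgroup (closed_commutator H).
Proof. exact/closure_is_subgroup/smallest_is_subgroup. Qed.

Lemma closed_commutator_comm H x y : H x -> H y -> closed_commutator H [~ x, y].
Proof.
move=> Hx Hy; apply: subset_closure; apply: sub_gen_smallest.
by exists x => //; exists y.
Qed.

Lemma closed_commutator_min H R :
  closed R -> is_subgroup R -> (forall x y, H x -> H y -> R [~ x, y]) ->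
  closed_commutator H `<=` R.
Proof.
move=> cR sR RH; rewrite ((closure_id R).1 cR); apply: closureS.
by apply: smallest_sub => // _ [x Hx [y Hy <-]]; exact: RH.
Qed.

Lemma closed_commutator_le H : closed H -> is_subgroup H -> closed_commutator H `<=` H.
Proof. by move=> cH sH; apply: closed_commutator_min => // x y; exact: subgR. Qed.

Lemma closed_commutatorS H R : H `<=` R -> closed_commutator H `<=` closed_commutator R.
Proof.
move=> HR; apply: closed_commutator_min; first exact: closed_closure.
  exact: closed_commutator_subgroup.
by move=> x y /HR Rx /HR; exact: closed_commutator_comm.
Qed.

Lemma closed_commutatorJ H x y : closed H -> is_subgroup H ->
  closed_commutator H x -> H y -> closed_commutator H (x ^ y).
Proof.
move=> cH sH cx Hy; have Hx := closed_commutator_le cH sH cx.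
have [_ cM _] := closed_commutator_subgroup H.
by rewrite -(mulKVg x (x ^ y)) -commgEl; apply: cM => //; exact: closed_commutator_comm.
Qed.

Lemma open_normal_subgroup O :
  compact [set: G] -> hausdorff_space G -> totally_disconnected [set: G] ->
  nbhs 1 O -> exists N, [/\ open N, is_normal_subgroup N & N `<=` O].
Proof.
move=> cG hG tdG O1.
have zG := compact_totally_disconnected_zero_dimensional cG hG tdG.
have [W [W1 [oW cW]] WO] := zero_dimensional_cvg hG zG cG O1.
(* the normal core of the right stabilizer of W, open because W is clopen *)
pose N := [set g | forall x w, W (w * g ^ x) <-> W w].
have sN : is_subgroup N.
  split=> [x w|g h Ng Nh x w|g Ng x w]; first by rewrite conj1g mulg1.
    by rewrite conjMg mulgA; split=> [/Nh/Ng|/Ng/Nh].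
  by rewrite -(Ng x) conjVg mulgKV.
have nN : is_normal_subgroup N.
  by split=> // g y Ng x w; rewrite -conjgM; exact: Ng.
exists N; split=> //; last by move=> g /(_ 1 1); rewrite conjg1 mul1g => /iffRL/(_ W1)/WO.
apply: subgroup_open => //.
(* Near each pair (x, w) continuity and clopenness of W give a neighbourhood of 1 that works;
   compactness of G x G makes it uniform. *)
have /compact_near_coveringP cov := compact_setX cG cG.
have : \forall g \near nbhs (1 : G), [set: G] `*` [set: G] `<=`
    (fun q => W (q.2 * g ^ q.1) <-> W q.2).
  apply: cov => -[x w] _.
  have actc : continuous (fun u : (G * G) * G => u.1.2 * u.2 ^ u.1.1).
    apply: continuousMg; last apply: continuousJg.
    - by move=> u; apply: continuous_comp; [exact: cvg_fst|exact: cvg_snd].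
    - by move=> u; exact: cvg_snd.
    - by move=> u; apply: continuous_comp; [exact: cvg_fst|exact: cvg_fst].
  have projc : continuous (fun u : (G * G) * G => u.1.2).
    by move=> u; apply: continuous_comp; [exact: cvg_fst|exact: cvg_snd].
  have act1 : w * 1 ^ x = w by rewrite conj1g mulg1.
  have pick A : open A -> A w -> \forall u \near ((x, w), 1 : G),
      A (u.1.2 * u.2 ^ u.1.1) /\ A u.1.2.
    move=> oA Aw; apply: filterI.
      by apply: actc; apply: open_nbhs_nbhs; rewrite act1.
    by apply: projc; exact: open_nbhs_nbhs.
  have [Ww|Ww] := pselect (W w).
    by apply: filterS (pick W oW Ww) => u [].
  by apply: filterS (pick (~` W) (closed_openC cW) Ww) => u [].
by apply: filterS => g Ng x w; exact: (Ng (x, w)).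
Qed.

End TopologicalGroups.

(** * Finite quotients of pro-p groups *)

Section FiniteQuotients.
Local Open Scope group_scope.
Variable G : topologicalGroupType.
Implicit Types (x y g h : G) (N O : set G).

Let coset N x := [set x * y | y in N].

Let coset_eqP N x y : is_subgroup N -> coset N x = coset N y <-> N (x^-1 * y).
Proof.
move=> [N1 NM NV]; split=> [xy|Nxy].
  have : coset N x y by rewrite xy; exists 1 => //; rewrite mulg1.
  by case=> z Nz <-; rewrite mulKg.
apply/seteqP; split=> _ [z Nz <-].
  exists (y^-1 * x * z); last by rewrite !mulgA mulgV mul1g.
  by apply: (NM) => //; rewrite -[x]invgK -invgM; exact: NV.
exists (x^-1 * y * z); last by rewrite !mulgA mulgV mul1g.
exact: NM.
Qed.

Lemma open_lcosets_finite N : compact [set: G] -> open N -> is_subgroup N ->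
  exists n, (Defs.lcosets N #= `I_n)%card.
Proof.
move=> /compact_near_coveringP cov oN sN; have [N1 NM NV] := sN.
(* Finite sets directed by inclusion: along this filter, the near-covering form of compactness
   produces one finite set meeting every coset. *)
pose F := filter_from (@finite_set G) (fun A => [set B | finite_set B /\ A `<=` B]).
have FF : Filter F.
  apply: filter_from_filter; first by exists set0; exact: finite_set0.
  move=> A B fA fB; exists (A `|` B); first by rewrite finite_setU.
  by move=> C [fC]; rewrite subUset => -[AC BC].
have [A fA FA] : F [set B : set G | setT `<=` [set x | exists2 d, B d & N (d^-1 * x)]].
  apply: (cov _ F (fun B x => exists2 d, B d & N (d^-1 * x))) => x _.
  exists ([set y | N (x^-1 * y)], [set B | B x]); last first.
    by case=> y B [/= Ny Bx]; exists x.
  split=> /=; last first.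
    by exists [set x]; [exact: finite_set1|move=> B [_ xB]; exact: xB].
  apply: nbhs_lmulg; rewrite mulVg; exact: open_nbhs_nbhs.
have {FA}GA := FA A (conj fA (@subset_refl _ A)).
apply/finite_setP; apply: (@sub_finite_set _ _ (coset N @` A)); last first.
  exact: finite_image.
move=> _ [x _ <-]; have [//|d Ad Nd] := GA x.
by exists d => //; apply/coset_eqP.
Qed.

(** G / N is realised through its regular action on the n numbered cosets. Normality of N makes the
    kernel of this permutation representation exactly N. *)
Lemma finite_quotient N n : is_normal_subgroup N -> (Defs.lcosets N #= `I_n)%card ->
  exists (F : finGroupType) (phi : G -> F),
    [/\ {morph phi : x y / x * y}, forall s, exists g, phi g = s,
        forall g, phi g = 1 <-> N g & #|F| = n].
Proof.
move=> [sN nN] /pcard_eqP[f].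
have [N1 NM NV] := sN.
have cN x : Defs.lcosets N (coset N x) by exists x.
have fn x : (f (coset N x) < n)%N by exact: (@funS _ _ _ _ f _ (cN x)).
pose nu x := Ordinal (fn x).
have nuE x y : nu x = nu y <-> N (x^-1 * y).
  rewrite -coset_eqP //; split=> [/(congr1 val) /= fxy|xy].
    by apply: (@inj _ _ _ f) fxy; exact/mem_set/cN.
  by apply: val_inj; rewrite /= xy.
have /fin_all_exists[sigma sigmaK] i : exists x, nu x = i.
  have [_ [x _ <-] fx] := @surj _ _ _ _ f (val i) (ltn_ord i).
  by exists x; apply: val_inj.
have sigmaN x : N ((sigma (nu x))^-1 * x) by apply/nuE.
have nuM g x y : nu x = nu y -> nu (g * x) = nu (g * y).
  by move=> /nuE xy; apply/nuE; rewrite invgM -mulgA mulKg.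
(* the action of G on the cosets of N, composed left to right as in 'S_n *)
pose act g (i : 'I_n) := nu (g^-1 * sigma i).
have actM g h i : act (g * h) i = act h (act g i).
  by rewrite /act invgM -mulgA; apply: nuM; rewrite sigmaK.
have act1 i : act 1 i = i by rewrite /act invg1 mul1g.
have act_inj g : injective (act g).
  by apply: (@can_inj _ _ _ (act g^-1)) => i; rewrite -actM mulgV act1.
pose s g := perm (@act_inj g).
have sM : {morph s : g h / g * h}.
  by move=> g h; apply/permP => i; rewrite permM !permE actM.
have s1 g : s g = 1 <-> N g.
  split=> [/permP/(_ (nu 1))|Ng]; last first.
    apply/permP => i; rewrite permE perm1 -[RHS]sigmaK; apply/nuE.
    by rewrite invgM invgK -mulgA; exact: nN.
  rewrite permE perm1 -{2}[nu 1]sigmaK => /nuE; rewrite invgM invgK -mulgA.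
  by move=> /(nN _ (sigma (nu 1))^-1); rewrite conjgE invgK -[(_ * _) * _^-1]mulgA mulVKg mulgK.
have s1' : s 1 = 1 by apply/s1.
have sV g : s g^-1 = (s g)^-1.
  by apply: (mulgI (s g)); rewrite -sM !mulgV.
have sE g h : s g = s h <-> N (g^-1 * h).
  rewrite -s1 sM sV; split=> [->|]; first by rewrite mulVg.
  by move=> /mulg1_eq; rewrite invgK.
(* The image of [s], listed by one representative per coset so that its cardinal is n. *)
pose D := [set s (sigma i) | i : 'I_n]%SET.
have sD g : s g \in D by apply/imsetP; exists (nu g) => //; apply/sE/nuE; rewrite sigmaK.
have gD : group_set D.
  apply/group_setP; split=> [|_ _ /imsetP[i _ ->] /imsetP[j _ ->]].
    by rewrite -s1' sD.
  by rewrite -sM sD.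
pose DG := group gD.
exists (subg_of DG), (fun g => subg DG (s g)); split.
- by move=> x y; rewrite sM subgM.
- move=> t; have /imsetP[i _ ti] := subgP t.
  by exists (sigma i); rewrite -ti sgvalK.
- move=> g; rewrite -s1; split=> [/(congr1 (@sgval _ DG))|->]; last first.
    by apply: val_inj; rewrite /= subgK ?group1.
  by rewrite subgK.
- rewrite card_sub card_imset ?card_ord // => i j /sE/nuE.
  by rewrite !sigmaK.
Qed.

Definition finite_p_quotient (p : nat) (F : finGroupType) (phi : G -> F) :=
  [/\ {morph phi : x y / x * y}, forall s, exists g, phi g = s,
      p.-group [set: F]%SET & open [set g | phi g = 1]].

(** The passage to finite p-groups: [O] is chosen to avoid whatever must stay nontrivial in the
    quotient. *)
Lemma pro_p_separation p O : is_pro_p G p -> prime p -> nbhs 1 O ->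
  exists (F : finGroupType) (phi : G -> F),
    finite_p_quotient p phi /\ forall g, phi g = 1 -> O g.
Proof.
move=> [cG hG tG pG] p_pr O1.
have [N [oN nN NO]] := open_normal_subgroup cG hG tG O1.
have [k /(finite_quotient nN)[F [phi [phiM phi_surj phi1 cF]]]] := pG N oN nN.
exists F, phi; split=> [|g /phi1/NO //]; split=> //.
  by rewrite /pgroup cardsT cF pnatX pnat_id.
suff -> : [set g | phi g = 1] = N by [].
by apply/seteqP; split=> g /phi1.
Qed.

End FiniteQuotients.

(** * Direct products of pro-p groups *)

Section Products.
Local Open Scope group_scope.

Lemma mulg_pairE (G1 G2 : topologicalGroupType) (x y : G1 * G2) :
  x * y = (x.1 * y.1, x.2 * y.2).
Proof. by []. Qed.

Lemma expg_pairE (G1 G2 : topologicalGroupType) (x : G1 * G2) n :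
  x ^+ n = (x.1 ^+ n, x.2 ^+ n).
Proof. by elim: n => [|n IHn]; rewrite ?expg0 // !expgS IHn. Qed.

Lemma morph_mulg1 (G H : groupType) (f : G -> H) : {morph f : x y / x * y} -> f 1 = 1.
Proof. by move=> fM; apply: (mulgI (f 1)); rewrite -fM !mulg1. Qed.

Lemma morph_mulgX (G H : groupType) (f : G -> H) x n :
  {morph f : x y / x * y} -> f (x ^+ n) = f x ^+ n.
Proof.
move=> fM; elim: n => [|n IHn]; first by rewrite !expg0 morph_mulg1.
by rewrite !expgS fM IHn.
Qed.

Lemma morph_mulgV (G H : groupType) (f : G -> H) x :
  {morph f : x y / x * y} -> f x^-1 = (f x)^-1.
Proof. by move=> fM; apply: (mulgI (f x)); rewrite -fM !mulgV morph_mulg1. Qed.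

Lemma morph_mulgR (G H : groupType) (f : G -> H) x y :
  {morph f : x y / x * y} -> f [~ x, y] = [~ f x, f y].
Proof. by move=> fM; rewrite !commgEl !conjgE !fM !morph_mulgV. Qed.

Lemma hausdorff_pair (S T : topologicalType) :
  hausdorff_space S -> hausdorff_space T -> hausdorff_space (S * T)%type.
Proof.
move=> hS hT [a b] [c d] cl; congr (_, _).
  apply: hS => A B aA cB; have [] := cl (A `*` setT) (B `*` setT).
  - by exists (A, setT) => //; split=> //; exact: filterT.
  - by exists (B, setT) => //; split=> //; exact: filterT.
  by move=> z [[Az _] [Bz _]]; exists z.1.
apply: hT => A B bA dB; have [] := cl (setT `*` A) (setT `*` B).
- by exists (setT, A) => //; split=> //; exact: filterT.
- by exists (setT, B) => //; split=> //; exact: filterT.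
by move=> z [[_ Az] [_ Bz]]; exists z.2.
Qed.

Lemma totally_disconnected_pair (S T : topologicalType) :
  totally_disconnected [set: S] -> totally_disconnected [set: T] ->
  totally_disconnected [set: (S * T)%type].
Proof.
move=> tS tT [a b] _; apply/seteqP; split=> [[c d] [R [Rab _ cR] Rcd]|_ ->]; last first.
  exact: connected_component_refl.
have image (V : topologicalType) (f : S * T -> V) : continuous f ->
    totally_disconnected [set: V] -> f (a, b) = f (c, d).
  move=> cf tV; have : connected_component setT (f (a, b)) (f (c, d)).
    exists (f @` R); last by exists (c, d).
    split; [by exists (a, b)|by []|].
    by apply: connected_continuous_connected => //; exact: continuous_subspaceT.
  by rewrite tV.
congr (_, _); first by rewrite -[c]/((c, d).1) -(image _ fst) // => x; exact: cvg_fst.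
by rewrite -[d]/((c, d).2) -(image _ snd) // => x; exact: cvg_snd.
Qed.

(** An open normal subgroup of the product need not be a product, so its index is not computed. It
    meets each axis in a neighbourhood of 1, hence contains all p^(k1 + k2)-th powers, and by Cauchy
    a finite group of p-power exponent is a p-group. *)
Lemma pro_p_prod p (G1 G2 : topologicalGroupType) : prime p ->
  is_pro_p G1 p -> is_pro_p G2 p -> is_pro_p (G1 * G2)%type p.
Proof.
move=> p_pr proG1 proG2.
case: (proG1) (proG2) => [c1 h1 t1 _] [c2 h2 t2 _].
have cG : compact [set: G1 * G2] by rewrite -setXTT; exact: compact_setX.
split=> //; [exact: hausdorff_pair|exact: totally_disconnected_pair|].
move=> N oN nN.
have [n cN] := open_lcosets_finite cG oN nN.1.
have [F [phi [phiM phi_surj phi1 cF]]] := finite_quotient nN cN.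
suff [k nE] : exists k, n = (p ^ k)%N by exists k; rewrite -nE.
have [nbhs1 nbhs2] : nbhs 1 [set x | N (x, 1 : G2)] /\ nbhs 1 [set y | N (1 : G1, y)].
  have [[A B] /= [A1 B1] AB] := open_nbhs_nbhs (conj oN (let: And3 N1 _ _ := nN.1 in N1)).
  split; [apply: filterS A1|apply: filterS B1] => z Az; apply: AB; split=> //=;
  exact: nbhs_singleton.
have [F1 [f1 [[f1M _ pF1 _] f1N]]] := pro_p_separation proG1 p_pr nbhs1.
have [F2 [f2 [[f2M _ pF2 _] f2N]]] := pro_p_separation proG2 p_pr nbhs2.
have [k1 k1E] := p_natP pF1; have [k2 k2E] := p_natP pF2.
have f1X x : f1 (x ^+ (p ^ k1)%N) = 1 by rewrite morph_mulgX // -k1E expg_cardG ?inE.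
have f2X x : f2 (x ^+ (p ^ k2)%N) = 1 by rewrite morph_mulgX // -k2E expg_cardG ?inE.
have NX g : N (g ^+ (p ^ (k1 + k2))%N).
  have [_ NM _] := nN.1.
  have -> : g ^+ (p ^ (k1 + k2))%N =
      (g.1 ^+ (p ^ (k1 + k2))%N, 1) * (1, g.2 ^+ (p ^ (k1 + k2))%N).
    by rewrite expg_pairE mulg_pairE /= mulg1 mul1g.
  apply: NM; [apply: f1N; rewrite addnC|apply: f2N]; by rewrite expnD expgnA.
have pF : p.-group [set: F]%SET.
  apply/pgroupP => q q_pr /(Cauchy q_pr)[s _ sq]; have [g gs] := phi_surj s.
  have : phi (g ^+ (p ^ (k1 + k2))%N) = 1 by apply/phi1.
  rewrite morph_mulgX // gs => /eqP; rewrite -order_dvdn sq.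
  by rewrite Euclid_dvdX // => /andP[]; rewrite dvdn_prime2 // => /eqP ->; rewrite inE.
by have [k kE] := p_natP pF; exists k; rewrite -cF -cardsT.
Qed.

End Products.

(** * Homomorphisms to Z/m *)

Local Open Scope ring_scope.

(* Z/m is represented by the integers up to congruence modulo m; the subset U
   is where the values of f matter. *)
Definition hom_mod (G : groupType) (U : G -> Prop) (m : nat) (f : G -> int) :=
  forall x y, U x -> U y -> (m %| f (x * y)%g - (f x + f y))%Z.

Section HomMod.
Variables (G : groupType) (U : G -> Prop) (m : nat) (f : G -> int).
Hypotheses (U1 : U 1%g) (UM : forall x y, U x -> U y -> U (x * y)%g).
Hypotheses (UV : forall x, U x -> U x^-1%g) (fM : hom_mod U m f).

Lemma hom_mod1 : (m %| f 1%g)%Z.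
Proof. by have := fM U1 U1; rewrite mulg1 opprD addrA subrr sub0r rpredN. Qed.

Lemma hom_modX x n : U x -> (m %| f (x ^+ n)%g - n%:Z * f x)%Z.
Proof.
move=> Ux; have UX k : U (x ^+ k)%g by elim: k => // k Uk; rewrite expgS; exact: UM.
elim: n => [|n IHn]; first by rewrite expg0 mul0r subr0 hom_mod1.
rewrite expgS.
have -> : f (x * x ^+ n)%g - n.+1%:Z * f x =
  (f (x * x ^+ n)%g - (f x + f (x ^+ n)%g)) + (f (x ^+ n)%g - n%:Z * f x).
  by rewrite -addn1 PoszD; ring.
by apply: rpredD => //; exact: fM.
Qed.

Lemma hom_modV x : U x -> (m %| f x^-1%g + f x)%Z.
Proof.
move=> Ux; have := fM (UV Ux) Ux; rewrite mulVg => h.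
have -> : f x^-1%g + f x = f 1%g - (f 1%g - (f x^-1%g + f x)) by ring.
by apply: rpredB => //; exact: hom_mod1.
Qed.

Lemma hom_modR x y : U x -> U y -> (m %| f [~ x, y]%g)%Z.
Proof.
move=> Ux Uy; have UR : U [~ x, y]%g by do ?[apply: UM|apply: UV|].
have := fM (UM Uy Ux) UR; rewrite -commgC => h.
have -> : f [~ x, y]%g = (f (x * y)%g - (f x + f y)) - (f (y * x)%g - (f y + f x)) -
    (f (x * y)%g - (f (y * x)%g + f [~ x, y]%g)) by ring.
by apply: rpredB h; apply: rpredB; exact: fM.
Qed.

End HomMod.

(** * Extending characters of finite groups *)

Section Extension.
Local Open Scope group_scope.
Variables (F : finGroupType) (D : {group F}) (m : nat).
Implicit Types (B : {group F}) (f : F -> int).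

Let mem_group B := fun x : F => x \in B.

(** On x = b a^i the extension is f b + i v. The last hypothesis makes it independent of i;
    vanishing on the derived subgroup makes it additive, as elements of D commute only modulo that
    subgroup. *)
Lemma hom_mod_adjoin B f a (v : int) :
  B \subset D -> D^`(1) \subset B -> hom_mod (mem_group B) m f ->
  (forall x, x \in D^`(1) -> (m %| f x)%Z) -> a \in D ->
  (forall i, a ^+ i \in B -> (m %| f (a ^+ i) - i%:Z * v)%Z) ->
  exists f', [/\ hom_mod (mem_group (B <*> <[a]>)) m f',
    (forall b, b \in B -> (m %| f' b - f b)%Z) & (m %| f' a - v)%Z].
Proof.
move=> BD DB fM f0 Da fa.
have nBD : D \subset 'N(B) by exact: sub_der1_norm.
have memP x : x \in B <*> <[a]> -> exists i, x * a ^- i \in B.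
  rewrite norm_joinEr; last by rewrite cycle_subG (fintype.subsetP nBD).
  by case/mulsgP => b _ Bb /cycleP[i ->] ->; exists i; rewrite mulgK.
(* Some exponent i with x a^-i in B, and 0 when there is none. By [wf], any other such exponent
   gives the same value modulo m. *)
pose ind x := if pselect (exists i, x * a ^- i \in B) is left h then xchoose h else 0%N.
have indP x : x \in B <*> <[a]> -> x * a ^- ind x \in B.
  by move=> /memP h; rewrite /ind; case: pselect => // h'; exact: (xchooseP h').
pose f' x := (f (x * a ^- ind x)%g + (ind x)%:Z * v)%R.
have wf x i : x \in B <*> <[a]> -> x * a ^- i \in B ->
    (m %| f' x - (f (x * a ^- i)%g + i%:Z * v)%R)%Z.
  move=> Bx; rewrite /f'; have := indP x Bx; move: (ind x) => j.
  have key i' j' : (i' <= j')%N -> x * a ^- i' \in B -> x * a ^- j' \in B ->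
      (m %| (f (x * a ^- i')%g + i'%:Z * v) - (f (x * a ^- j')%g + j'%:Z * v))%Z.
    move=> ij Bi Bj; have aE : a ^+ (j' - i') = (x * a ^- j')^-1 * (x * a ^- i').
      by rewrite expgnFr // invgM invgK -!mulgA mulKg.
    have Ba : a ^+ (j' - i') \in B by rewrite aE groupM ?groupV.
    have := fM _ _ Bj Ba; rewrite {1}aE mulKVg => h.
    have -> : ((f (x * a ^- i')%g + i'%:Z * v) - (f (x * a ^- j')%g + j'%:Z * v) =
      (f (x * a ^- i')%g - (f (x * a ^- j')%g + f (a ^+ (j' - i'))%g)) +
      (f (a ^+ (j' - i'))%g - (j' - i')%N%:Z * v))%R.
      by rewrite -subzn //; ring.
    by apply: rpredD => //; exact: fa.
  by move=> Bj Bi; case/orP: (leq_total i j) => ij; last exact: key;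
    rewrite -opprB rpredN; exact: key.
exists f'; split=> [x y Bx By|b Bb|].
- have /memP[i Bi] := Bx; have /memP[j Bj] := By.
  (* The price of moving a^-i past the B-part of y; f vanishes on it modulo m. *)
  pose c := [~ y * a ^- j, a ^- i].
  have Dc : c \in D^`(1).
    by apply: mem_commg; [exact: (fintype.subsetP BD)|rewrite groupV groupX].
  have xyE : x * y * a ^- (i + j) = (x * a ^- i) * ((y * a ^- j) * c).
    rewrite /c -conjg_mulR conjgE !mulgA mulgK -!mulgA.
    by congr (_ * (_ * _)); rewrite expgnDr invgM.
  have Bxy : x * y * a ^- (i + j) \in B.
    by rewrite xyE; exact: groupM Bi (groupM Bj (fintype.subsetP DB _ Dc)).
  have h := wf _ _ (groupM Bx By) Bxy; rewrite xyE PoszD in h.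
  have hYc := fM _ _ Bj (fintype.subsetP DB _ Dc).
  have hXYc := fM _ _ Bi (groupM Bj (fintype.subsetP DB _ Dc)).
  have -> : (f' (x * y)%g - (f' x + f' y) =
    (f' (x * y)%g - (f ((x * a ^- i) * ((y * a ^- j) * c))%g + (i%:Z + j%:Z) * v))
    - (f' x - (f (x * a ^- i)%g + i%:Z * v)) - (f' y - (f (y * a ^- j)%g + j%:Z * v))
    + (f ((x * a ^- i) * ((y * a ^- j) * c))%g -
        (f (x * a ^- i)%g + f ((y * a ^- j) * c)%g))
    + (f ((y * a ^- j) * c)%g - (f (y * a ^- j)%g + f c)) + f c)%R by ring.
  apply: rpredD (f0 _ Dc); apply: rpredD hYc; apply: rpredD hXYc.
  by apply: rpredB; [apply: rpredB => //|]; exact: wf.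
- have := wf b 0%N; rewrite expg0 invg1 mulg1 mul0r addr0; apply=> //.
  by rewrite mem_gen // inE Bb.
- have := wf a 1%N; rewrite expg1 mulgV mul1r => h.
  have -> : (f' a - v = (f' a - (f 1%g + v)) + f 1%g)%R by ring.
  apply: rpredD; last exact/f0/group1.
  by apply: h; rewrite ?group1 // mem_gen // inE cycle_id orbT.
Qed.

Lemma min_expg_mem B a : exists j, [/\ (0 < j)%N, a ^+ j \in B &
  forall i, (a ^+ i \in B) = (j %| i)%N].
Proof.
have exj : exists j, (0 < j)%N && (a ^+ j \in B).
  by exists #[a]; rewrite order_gt0 expg_order group1.
exists (ex_minn exj); case: ex_minnP => j /andP[j0 Bj] jmin.
split=> // i; apply/idP/idP => [Bi|/dvdnP[k ->]]; last first.
  by rewrite mulnC expgnA groupX.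
have Br : a ^+ (i %% j) \in B.
  move: Bi; rewrite {1}(divn_eq i j) expgnDr groupMl //.
  by rewrite mulnC expgnA groupX.
rewrite /dvdn -leqn0 leqNgt; apply/negP => r0.
by have := jmin (i %% j)%N; rewrite r0 Br leqNgt ltn_pmod // => /(_ isT).
Qed.

(* Baer's criterion for the Z/m-module Z/m: if a ^+ j is the first power of a
   lying in B, then j divides m, and f (a ^+ m) = 0 makes f (a ^+ j) divisible
   by j. *)
Lemma hom_mod_extend B f :
  (0 < m)%N -> B \subset D -> D^`(1) \subset B -> hom_mod (mem_group B) m f ->
  (forall x, x \in D^`(1) -> (m %| f x)%Z) ->
  (forall u, u \in D -> u ^+ m \in B /\ (m %| f (u ^+ m)%g)%Z) ->
  exists chi, hom_mod (mem_group D) m chi /\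
    forall b, b \in B -> (m %| chi b - f b)%Z.
Proof.
move=> m0; have [n leDB] := ubnP (#|D| - #|B|).
elim: n => // n IHn in B f leDB *.
move=> BD DB fM f0 fX.
have [DB'|/subsetPn[a Da nBa]] := boolP (D \subset B).
  have BeD : B :=: D by apply/eqP; rewrite finset.eqEsubset BD.
  exists f; split=> [x y|b _]; last by rewrite subrr dvdz0.
  by rewrite /mem_group -BeD; exact: fM.
have [j [j0 Bj jP]] := min_expg_mem B a.
have B1 := group1 B; have BM := @groupM _ B; have BV := fun x => @groupVr _ B x.
have fXB k : (m %| f (a ^+ (j * k))%g - k%:Z * f (a ^+ j)%g)%Z.
  by rewrite expgnA; exact: (hom_modX B1 BM fM).
have /dvdzP[v vE] : (j%:Z %| f (a ^+ j)%g)%Z.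
  have [Bm fm] := fX a Da; move: Bm; rewrite jP => /dvdnP[k mE].
  have := fXB k; rewrite mulnC -mE => /(rpredB fm); rewrite subKr mE PoszM dvdz_mul2l //.
  by apply/eqP => -[k0]; rewrite mE k0 in m0.
have fa i : a ^+ i \in B -> (m %| f (a ^+ i)%g - i%:Z * v)%Z.
  rewrite jP => /dvdnP[k ->].
  have -> : ((k * j)%N%:Z * v = k%:Z * f (a ^+ j)%g)%R by rewrite vE PoszM; ring.
  by rewrite mulnC; exact: fXB.
have [f' [f'M f'f _]] := hom_mod_adjoin BD DB fM f0 Da fa.
have BB' : B \subset B <*> <[a]> by exact: joing_subl.
have [||||||chi [chiM chif]] := IHn (B <*> <[a]>)%G f'.
- rewrite -ltnS (leq_trans _ leDB) // ltnS; apply: ltn_sub2l.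
    by apply: proper_card; rewrite properE BD; apply/subsetPn; exists a.
  apply: proper_card; rewrite properE BB' /=; apply/subsetPn; exists a => //.
  by rewrite mem_gen // inE cycle_id orbT.
- by rewrite join_subG BD cycle_subG.
- exact: fintype.subset_trans DB BB'.
- by [].
- move=> x Dx; rewrite -[f' x](subrK (f x)).
  by apply: rpredD (f'f _ (fintype.subsetP DB _ Dx)) (f0 _ Dx).
- move=> u /fX[Bu fu]; split; first exact: (fintype.subsetP BB').
  by rewrite -[f' _](subrK (f (u ^+ m))); apply: rpredD (f'f _ Bu) fu.
exists chi; split=> // b Bb; rewrite -[chi b](subrK (f' b)) -addrA.
by apply: rpredD; [apply: chif; exact: (fintype.subsetP BB')|exact: f'f].
Qed.

(** With m = #|D| every m-th power is 1, so the extension criterion is immediate. If y has order j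
    modulo D', it can be sent to m / j, which is nonzero modulo m because j > 1. *)
Lemma hom_mod_separation y : m = #|D| -> y \in D -> y \notin D^`(1) ->
  exists chi, hom_mod (mem_group D) m chi /\ ~~ (m %| chi y)%Z.
Proof.
move=> mD Dy nD'y; have [j [j0 D'j jP]] := min_expg_mem D^`(1)%G y.
have m0 : (0 < m)%N by rewrite mD cardG_gt0.
have uX u : u \in D -> u ^+ m = 1 by move=> Du; rewrite mD expg_cardG.
have /dvdnP[k mE] : (j %| m)%N by rewrite -jP uX // group1.
have [||||||f [fM f0 fy]] := @hom_mod_adjoin D^`(1)%G (fun=> 0) y k%:Z.
- exact: der_sub.
- by [].
- by move=> u v _ _; exact: dvdz0.
- by move=> u _; rewrite dvdz0.
- by [].
- move=> i; rewrite jP sub0r rpredN => /dvdnP[l ->].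
  by apply/dvdzP; exists l%:Z; rewrite mE !PoszM; ring.
have f0' x : x \in D^`(1) -> (m %| f x)%Z by move=> /f0; rewrite subr0.
have [|||||chi [chiM chif]] := @hom_mod_extend (D^`(1) <*> <[y]>)%G f m0.
- by rewrite join_subG der_sub cycle_subG.
- exact: joing_subl.
- by [].
- by [].
- by move=> u /uX ->; rewrite group1; split=> //; apply: f0'; exact: group1.
exists chi; split=> //; apply/negP => chiy.
have By : y \in D^`(1) <*> <[y]> by rewrite mem_gen // inE cycle_id orbT.
have : (m %| k%:Z)%Z.
  have -> : (k%:Z = chi y - (chi y - f y) - (f y - k%:Z))%R by ring.
  by apply: rpredB fy; apply: rpredB chiy _; exact: chif.
have k0 : (0 < k)%N by move: m0; rewrite mE muln_gt0 => /andP[].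
have j1 : (1 < j)%N.
  by rewrite ltn_neqAle j0 andbT; apply: contraNneq nD'y => j1; rewrite -(expg1 y) jP -j1.
rewrite /dvdz /= mE => /dvdn_leq => /(_ k0).
by rewrite -[leqRHS]muln1 leq_pmul2l // leqNgt j1.
Qed.

End Extension.

(** * Separation of points by finite p-quotients *)

Section CentralQuotient.
Local Open Scope group_scope.

Lemma p_group_max_normal (p : nat) (gT : finGroupType) (G : {group gT}) t :
  p.-group G -> prime p -> t \in G -> t != 1 ->
  exists M : {group gT}, [/\ M <| G, t \notin M, t ^+ p \in M
    & forall g, g \in G -> [~ t, g] \in M].
Proof.
move=> pG p_pr Gt t1.
(* every nontrivial normal subgroup of G / M contains the image of t,
   in particular the one generated by a central element of order p *)
have [|M /maxgroupP[/andP[nMG nMt] maxM]] :=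
    @ex_maxgroup _ (fun M : {group gT} => (M <| G) && (t \notin M)).
  by exists 1%G; rewrite normal1 inE.
have nM : G \subset 'N(M) by exact: normal_norm.
have pQ : p.-group (G / M) by exact: quotient_pgroup.
have Qt : coset M t \in G / M by exact: mem_quotient.
have cosetE x : x \in G -> (coset M x == 1) = (x \in M).
  by move=> Gx; apply/eqP/idP; [move/coset_idr|move/coset_id] => // ->;
    rewrite ?(fintype.subsetP nM).
have ntQ : G / M != 1.
  by apply: contraTneq Qt => ->; rewrite inE cosetE.
have ntZ : 'Z(G / M) != 1 by rewrite (center_nil_eq1 (pgroup_nil pQ)).
have pZ : p.-group 'Z(G / M) by exact: pgroupS (center_sub _) pQ.
have [_ /(Cauchy p_pr)[u Zu ou] _] := pgroup_pdiv pZ ntZ.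
have nuQ : <[u]> <| G / M.
  by apply: sub_center_normal; rewrite cycle_subG.
have [K uE sMK nKG] := inv_quotientN nMG nuQ.
have tu : coset M t \in <[u]>.
  apply: contraT => ntu.
  have KM : K :=: M.
    apply: maxM => //; rewrite nKG; apply: contra ntu => Kt.
    by rewrite uE; exact: mem_quotient.
  have : u \in <[u]> by exact: cycle_id.
  rewrite uE KM trivg_quotient inE => /eqP u1.
  by move: p_pr; rewrite -ou u1 order1.
exists M; split=> //.
- rewrite -cosetE ?groupX // morphX ?(fintype.subsetP nM) //.
  by rewrite -order_dvdn -ou order_dvdG.
- move=> g Gg; rewrite -cosetE ?groupR // morphR ?(fintype.subsetP nM) //.
  apply/commgP; change (commute (coset M t) (coset M g)).
  have /cycleP[i ->] := tu; apply/commute_sym/commuteX/commute_sym.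
  by case/setIP: Zu => _ /centP; apply; exact: mem_quotient.
Qed.

End CentralQuotient.

Section Separation.
Local Open Scope group_scope.
Variables (p : nat) (G : topologicalGroupType).

Lemma finite_p_quotient_open (F : finGroupType) (phi : G -> F) (A : set F) :
  finite_p_quotient p phi -> open (phi @^-1` A).
Proof.
move=> [phiM _ _ oker]; rewrite openE => x Ax.
have : nbhs x [set y | [set g | phi g = 1] (x^-1 * y)].
  by apply: nbhs_lmulg; rewrite mulVg; apply: open_nbhs_nbhs; split=> //; exact: morph_mulg1.
apply: filterS => y /=; rewrite phiM morph_mulgV // => /mulg1_eq; rewrite invgK => xy.
by rewrite /preimage /= -xy.
Qed.

Lemma preimage_group (F : finGroupType) (phi : G -> F) (D : {group F}) :
  {morph phi : x y / x * y} -> open [set g | phi g = 1] ->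
  open (phi @^-1` (fun s => s \in D)) /\ is_subgroup (phi @^-1` (fun s => s \in D)).
Proof.
move=> phiM oker; set U := phi @^-1` _.
have sU : is_subgroup U.
  split=> [|g h Ug Uh|g Ug]; rewrite /U /preimage /=.
  - by rewrite morph_mulg1 // group1.
  - by rewrite phiM; exact: (@groupM _ D).
  - by rewrite morph_mulgV //; exact: (@groupVr _ D).
split=> //; apply: subgroup_open => //.
apply: filterS (open_nbhs_nbhs (conj oker _)) => [g /= phig|]; last exact: morph_mulg1.
by rewrite /U /preimage /= phig group1.
Qed.

Hypotheses (p_pr : prime p) (proG : is_pro_p G p).

Lemma pro_p_separate_points t : t != 1 ->
  exists (F : finGroupType) (phi : G -> F), finite_p_quotient p phi /\ phi t <> 1.
Proof.
move=> t1; have [_ hG _ _] := proG.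
have : nbhs 1 (~` [set t]).
  apply: open_nbhs_nbhs; split; last by move=> /= t1'; rewrite t1' eqxx in t1.
  apply: closed_openC; apply: accessible_closed_set1; exact: hausdorff_accessible.
move=> /(pro_p_separation proG p_pr)[F [phi [phiq phit]]].
by exists F, phi; split=> // /phit; apply.
Qed.

Lemma pro_p_separate_central t : t != 1 ->
  exists (F : finGroupType) (phi : G -> F),
    [/\ finite_p_quotient p phi, phi t <> 1, phi t ^+ p = 1
      & forall g, commute (phi t) (phi g)].
Proof.
move=> /pro_p_separate_points[F [phi [phiq /eqP phit]]].
have [phiM phi_surj pF oker] := phiq.
have [M [nMF nMt Mtp MR]] := p_group_max_normal pF p_pr (finset.in_setT _) phit.
have nM x : x \in 'N(M) by apply: (fintype.subsetP (normal_norm nMF)); rewrite inE.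
have psiM : {morph (coset M \o phi) : x y / x * y}.
  by move=> x y /=; rewrite phiM morphM.
exists _, (coset M \o phi); split.
- split=> //.
  + move=> s; have [g gs] := phi_surj (repr s); exists g.
    by rewrite /= gs coset_reprK.
  + have -> : [set: coset_of M]%SET = [set: F]%SET / M.
      apply/esym/setP => s; rewrite finset.in_setT -(coset_reprK s).
      by rewrite mem_quotient ?finset.in_setT.
    exact: quotient_pgroup.
  + have -> : [set g | (coset M \o phi) g = 1] = phi @^-1` [set s | coset M s = 1] by [].
    exact: finite_p_quotient_open phiq.
- by move/coset_idr; rewrite nM => /(_ isT); apply/negP.
- by rewrite /= -morphX //; exact: coset_id.
- move=> g; apply/commgP; rewrite /= -morphR //; apply/eqP/coset_id/MR.
  by rewrite finset.in_setT.
Qed.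

End Separation.

(** * Cocycles with integer values *)

Local Open Scope quotient_scope.

Lemma dvdz_modBl (a b : int) (m : nat) : (m %| (a %% m)%Z - b)%Z = (m %| a - b)%Z.
Proof. by rewrite -!eqz_mod_dvd modz_mod. Qed.

Lemma dvdz_modB (a : int) (m : nat) : (m %| (a %% m)%Z - a)%Z.
Proof. by rewrite dvdz_modBl subrr dvdz0. Qed.

Section PadicResidues.
Variable p : nat.
Hypothesis p_gt0 : (0 < p)%N.
Implicit Types x y z : padic p.

Lemma digits_ofint a n : digits (padic_of_int p a) n = (a %% (p ^ n)%N)%Z.
Proof. by []. Qed.

Lemma digitsD x y n : ((p ^ n)%N %| digits (x + y) n - (digits x n + digits y n))%Z.
Proof. exact: dvdz_modB. Qed.

Lemma digitsM x y n : ((p ^ n)%N %| digits (x * y) n - digits x n * digits y n)%Z.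
Proof. exact: dvdz_modB. Qed.

Lemma digits0 n : digits (0 : padic p) n = 0.
Proof. exact: mod0z. Qed.

Lemma digits_le x n k : ((p ^ n)%N %| digits x (n + k)%N - digits x n)%Z.
Proof.
elim: k => [|k IHk]; first by rewrite addn0 subrr dvdz0.
have -> : digits x (n + k.+1)%N - digits x n =
  (digits x (n + k.+1)%N - digits x (n + k)%N) + (digits x (n + k)%N - digits x n) by ring.
apply: rpredD IHk; rewrite addnS [digits x (n + k)%N](svalP x).
rewrite -opprB rpredN; apply: (@dvdz_trans (p ^ (n + k))%N); last exact: dvdz_modB.
by rewrite expnD PoszM dvdz_mulr.
Qed.

Lemma digitsB x y n : ((p ^ n)%N %| digits (x - y) n - (digits x n - digits y n))%Z.
Proof.
have := digitsD (x - y) y n; rewrite subrK -rpredN => /=.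
by congr (_ %| _)%Z; ring.
Qed.

Lemma digitsMn x k n : ((p ^ n)%N %| digits (x *+ k) n - digits x n * k%:Z)%Z.
Proof.
elim: k => [|k IHk]; first by rewrite mulr0n digits0 mulr0 subr0.
rewrite mulrS; have -> : digits (x + x *+ k) n - digits x n * k.+1%:Z =
    (digits (x + x *+ k) n - (digits x n + digits (x *+ k) n)) +
    (digits (x *+ k) n - digits x n * k%:Z) by rewrite -addn1 PoszD; ring.
by apply: rpredD IHk; exact: digitsD.
Qed.

Lemma digits_mod x n : (digits x n %% (p ^ n)%N)%Z = digits x n.
Proof. by rewrite [digits x n](svalP x) modz_mod. Qed.

Lemma padic_eqP x y :
  (forall n, ((p ^ n)%N %| digits x n - digits y n)%Z) -> x = y.
Proof.
move=> xy; apply: padic_eq => n; rewrite -(digits_mod x) -(digits_mod y).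
by apply/eqP; rewrite eqz_mod_dvd.
Qed.

Lemma padic_dvdP x n :
  (exists z, x = z *+ p ^ n) <-> ((p ^ n)%N %| digits x n)%Z.
Proof.
have pn0 k : (p ^ k)%N%:Z != 0 by rewrite -lt0n expn_gt0 p_gt0.
split=> [[z ->]|xn].
  have := rpredD (digitsMn z (p ^ n) n) (dvdz_mull (digits z n) (dvdzz (p ^ n)%N)).
  by rewrite subrK.
have xnk k : ((p ^ n)%N %| digits x (n + k)%N)%Z.
  by rewrite -(subrK (digits x n) (digits x (n + k)%N)) rpredD // digits_le.
(* The digits of x / p^n: shift by n places, then divide exactly. *)
pose q k := (digits x (n + k)%N %/ (p ^ n)%N)%Z.
have qE k : digits x (n + k)%N = (p ^ n)%N%:Z * q k by rewrite mulrC divzK.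
have qP : is_padic p q.
  move=> k; apply: (mulfI (pn0 n)); rewrite -qE [LHS](svalP x).
  rewrite -[sval x _]/(digits x (n + k).+1) -addnS qE expnD PoszM.
  by rewrite mulz_modr // ltz_nat expn_gt0 p_gt0.
pose z : padic p := exist _ q qP; exists z.
apply: padic_eqP => k.
have -> : digits x k - digits (z *+ p ^ n) k = (q k * (p ^ n)%N%:Z - digits (z *+ p ^ n) k)
    - (digits x (k + n)%N - digits x k) by rewrite addnC qE; ring.
apply: rpredB; last exact: digits_le.
by rewrite -opprB rpredN; exact: digitsMn.
Qed.

End PadicResidues.

Section PadicMod.
Variable p : nat.
Hypothesis p_gt0 : (0 < p)%N.
Implicit Types (x y : padic p) (a b : int) (n : nat).

Definition res n (v : padic_mod p n) : int := digits (generic_quotient.repr v) n.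
Definition of_res n a : padic_mod p n := \pi_(padic_mod p n) (padic_of_int p a).

Lemma pi_padic_eqP n x y :
  \pi_(padic_mod p n) x = \pi_(padic_mod p n) y <->
  ((p ^ n)%N %| digits x n - digits y n)%Z.
Proof.
have -> : ((p ^ n)%N %| digits x n - digits y n)%Z = ((p ^ n)%N %| digits (x - y) n)%Z.
  apply/idP/idP => h.
    by rewrite -(subrK (digits x n - digits y n) (digits (x - y) n));
      exact: rpredD (digitsB _ _ _) h.
  rewrite -(subKr (digits (x - y) n) (digits x n - digits y n)).
  exact: rpredB h (digitsB _ _ _).
rewrite -padic_dvdP //; split=> [/eqP|]; first by rewrite -Quotient.idealrBE => /asboolP.
by move=> h; apply/eqP; rewrite -Quotient.idealrBE; apply/asboolP.
Qed.

Lemma res_pi n x : ((p ^ n)%N %| res (\pi_(padic_mod p n) x) - digits x n)%Z.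
Proof. by apply/pi_padic_eqP; rewrite reprK. Qed.

Lemma res_of_res n a : ((p ^ n)%N %| res (of_res n a) - a)%Z.
Proof.
rewrite -[X in X - _](subrK (digits (padic_of_int p a) n)) -addrA.
by apply: rpredD (res_pi _ _) _; exact: dvdz_modB.
Qed.

Lemma res_eqP n (u v : padic_mod p n) : u = v <-> ((p ^ n)%N %| res u - res v)%Z.
Proof. by rewrite -pi_padic_eqP !reprK. Qed.

Lemma of_res_eqP n a b : of_res n a = of_res n b <-> ((p ^ n)%N %| a - b)%Z.
Proof. by rewrite pi_padic_eqP !digits_ofint -!eqz_mod_dvd modz_mod eq_sym modz_mod eq_sym. Qed.

Lemma resK n (v : padic_mod p n) : of_res n (res v) = v.
Proof. by apply/res_eqP; exact: res_of_res. Qed.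

Lemma resD n (u v : padic_mod p n) : ((p ^ n)%N %| res (u + v) - (res u + res v))%Z.
Proof.
have -> : res (u + v) - (res u + res v) =
  (res (u + v) - digits (generic_quotient.repr u + generic_quotient.repr v) n) +
  (digits (generic_quotient.repr u + generic_quotient.repr v) n - (res u + res v)) by ring.
apply: rpredD; last exact: digitsD.
by rewrite -{1}[u]reprK -{1}[v]reprK -raddfD; exact: res_pi.
Qed.

End PadicMod.

Section Cocycles.
Variable p : nat.
Hypothesis p_gt0 : (0 < p)%N.

Lemma of_resD n a b : of_res p n (a + b) = of_res p n a + of_res p n b.
Proof.
apply/(res_eqP p_gt0); rewrite -(subrK (a + b) (res _)) -addrA.
apply: rpredD; first exact: res_of_res.
have := rpredD (res_of_res p_gt0 n a) (res_of_res p_gt0 n b).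
have := resD p_gt0 (of_res p n a) (of_res p n b) => h1 h2.
by rewrite -rpredN; apply: etrans (rpredD h1 h2); congr (_ %| _)%Z; ring.
Qed.

Lemma of_res0 n : of_res p n 0 = 0.
Proof. by apply: (addrI (of_res p n 0)); rewrite -of_resD !addr0. Qed.

Lemma digits_principal (x : padic p) n :
  (exists z, x = 1 + z *+ p ^ n) -> ((p ^ n)%N %| digits x n - 1)%Z.
Proof.
move=> [z xE].
have -> : digits x n - 1 = digits (x - 1) n -
    (digits (x - 1) n - (digits x n - digits (1%R : padic p) n))
    + (digits (1%R : padic p) n - 1) :> int by ring.
apply: rpredD; last exact: dvdz_modB.
apply: rpredB (digitsB _ _ _); apply/(padic_dvdP p_gt0).
by exists z; rewrite xE addrC addKr.
Qed.

Lemma of_res_scale n x a : scale_mod x (of_res p n a) = of_res p n (digits x n * a).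
Proof.
rewrite scale_mod_pi; apply/(pi_padic_eqP p_gt0); rewrite digits_ofint.
rewrite -(subrK (digits x n * a) (digits _ _)) -addrA; apply: rpredD; last first.
  by rewrite -rpredN opprB; exact: dvdz_modB.
rewrite -(subrK (digits x n * digits (padic_of_int p a) n) (digits _ _)) -addrA.
apply: rpredD; first exact: digitsM.
by rewrite -mulrBr dvdz_mull // digits_ofint dvdz_modB.
Qed.

Lemma red_of_res n a : red_mod (of_res p n.+1 a) = of_res p 1 a.
Proof. exact: red_mod_pi. Qed.

Lemma red_resE n (v : padic_mod p n.+1) : red_mod v = of_res p 1 (res v).
Proof. by rewrite -{1}(resK p_gt0 v) red_of_res. Qed.

Variables (G : topologicalGroupType) (theta : G -> padic p).
Implicit Types (U : set G) (c : G -> int).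

(* Cocycles of U in Z_p(1) / p^n, through integer representatives (m = p ^ n) *)
Definition twisted_hom U m n c := forall x y, U x -> U y ->
  (m %| c (x * y)%g - (c x + digits (theta x) n * c y))%Z.

(** Continuity of a cocycle into a discrete module: by the cocycle identity, being locally constant
    reduces to vanishing near 1. *)
Definition locally_zero U (m : nat) c :=
  \forall g \near (1%g : G), U g -> (m %| c g)%Z.

Lemma near_set_type U (x : U) (P : U -> Prop) :
  (\forall g \near (\val x : G), forall Ug : g \in U, P (exist _ g Ug)) ->
  \forall u \near x, P u.
Proof.
move=> h; have : \forall u \near x, forall Ug : \val u \in U, P (exist _ (\val u) Ug).
  exact: (@initial_continuous U G set_val x _ h).
apply: filterS => u Pu; have := Pu (valP u).
by congr P; apply: val_inj.
Qed.

Lemma set_type_near U (x : U) (P : U -> Prop) :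
  (\forall u \near x, P u) ->
  \forall g \near (\val x : G), forall Ug : g \in U, P (exist _ g Ug).
Proof.
case=> B [[C oC <-] /= Cx] CP.
apply: filterS (open_nbhs_nbhs (conj oC Cx)) => g Cg Ug.
exact: CP.
Qed.

Lemma near_lmul1 (x : G) (P : G -> Prop) : (\forall g \near (1%g : G), P (x * g)%g) ->
  \forall g \near x, P g.
Proof.
move=> h; have : nbhs x [set z | P (x * (x^-1 * z))%g].
  by apply: (nbhs_lmulg (A := [set g | P (x * g)%g])); rewrite mulVg.
by apply: filterS => z /=; rewrite mulKVg.
Qed.

Lemma twisted_cocycle U n c : is_subgroup U ->
  twisted_hom U (p ^ n)%N n c -> locally_zero U (p ^ n)%N c ->
  is_cocycle (twist theta n) (fun u : U => of_res p n (c (\val u))).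
Proof.
move=> sU cM c0; have [U1 UM UV] := sU; split.
  apply/continuous_discreteP => x; apply: near_set_type => /=.
  have Ux : U (\val x) by exact/set_mem/valP.
  apply: near_lmul1; apply: filterS c0 => g cg Uxg.
  have Ug : U g by apply: (subgMl sU Ux); exact: set_mem.
  apply/(of_res_eqP p_gt0).
  have -> : c (\val x * g)%g - c (\val x) = (c (\val x * g)%g -
    (c (\val x) + digits (theta (\val x)) n * c g)) + digits (theta (\val x)) n * c g by ring.
  by apply: rpredD; [exact: cM|exact/dvdz_mull/cg].
move=> g h k kE; rewrite /twist /= of_res_scale -of_resD; apply/(of_res_eqP p_gt0).
by rewrite kE; apply: cM; exact/set_mem/valP.
Qed.

(** Extended by 0 outside U, so that cocycles on U become functions on G; the congruences are only
    asserted on U. *)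
Definition ext_res U n (gamma : U -> padic_mod p n) (g : G) : int :=
  if insub g is Some u then res (gamma u) else 0.

Lemma ext_resE U n (gamma : U -> padic_mod p n) (u : U) :
  ext_res gamma (\val u) = res (gamma u).
Proof. by rewrite /ext_res valK. Qed.

Lemma cocycle_twisted U n (gamma : U -> padic_mod p n) : is_subgroup U ->
  is_cocycle (twist theta n) gamma -> twisted_hom U (p ^ n)%N n (ext_res gamma).
Proof.
move=> [_ UM _] [_ gM] x y Ux Uy; pose elt g Ug : U := exist _ g (mem_set Ug).
have := gM (elt x Ux) (elt y Uy) (elt _ (UM _ _ Ux Uy)) erefl.
move: (ext_resE gamma (elt x Ux)) (ext_resE gamma (elt y Uy)) => /= -> ->.
move: (ext_resE gamma (elt _ (UM _ _ Ux Uy))) => /= -> ->.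
apply/(of_res_eqP p_gt0).
by rewrite of_resD -of_res_scale !(resK p_gt0).
Qed.

Lemma cocycle_locally_zero U n (gamma : U -> padic_mod p n) : is_subgroup U ->
  theta 1%g = 1 -> is_cocycle (twist theta n) gamma ->
  locally_zero U (p ^ n)%N (ext_res gamma).
Proof.
move=> [U1 _ _] theta1 [/continuous_discreteP gc gM].
pose u1 : U := exist _ 1%g (mem_set U1).
have g1 : gamma u1 = 0.
  have := gM u1 u1 u1; rewrite mulg1 => /(_ erefl).
  rewrite /twist /= theta1 -{3}[gamma u1](resK p_gt0) of_res_scale.
  have -> : of_res p n (digits (1 : padic p) n * res (gamma u1)) = gamma u1.
    rewrite -[RHS](resK p_gt0); apply/(of_res_eqP p_gt0).
    by rewrite -[X in _ - X]mul1r -mulrBl dvdz_mulr // dvdz_modB.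
  by move/eqP; rewrite -subr_eq0 opprD addrA subrr sub0r oppr_eq0 => /eqP.
have := set_type_near (gc u1); apply: filterS => g Pg Ug.
have := ext_resE gamma (exist _ g (mem_set Ug)) => /= ->.
rewrite (Pg (mem_set Ug)) g1 -(subr0 (res _)); apply/(of_res_eqP p_gt0).
by rewrite (resK p_gt0) of_res0.
Qed.

(** 1-smoothness lifts the class of c, a priori up to a coboundary; that coboundary is zero modulo
    p, so C reduces to c itself. The last clause assumes theta 1 = 1, which makes a cocycle vanish
    at 1. *)
Lemma one_smooth_lift U n c : one_smooth theta ->
  (forall g, exists z, theta g = 1 + z *+ p) -> open U -> is_subgroup U ->
  hom_mod U p c -> locally_zero U p c ->
  exists C, [/\ twisted_hom U (p ^ n.+1)%N n.+1 C,
    forall g, U g -> (p %| C g - c g)%Z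
    & theta 1%g = 1 -> locally_zero U (p ^ n.+1)%N C].
Proof.
move=> smooth theta1 oU sU cM c0.
have theta1' g : (p %| digits (theta g) 1%N - 1)%Z.
  by have := digits_principal (x := theta g) (n := 1%N); rewrite expn1; apply.
have cM' : twisted_hom U (p ^ 1)%N 1 c.
  move=> x y Ux Uy; rewrite expn1.
  have -> : c (x * y)%g - (c x + digits (theta x) 1%N * c y) =
    (c (x * y)%g - (c x + c y)) - (digits (theta x) 1%N - 1) * c y by ring.
  by apply: rpredB; [exact: cM|exact: dvdz_mulr].
have c0' : locally_zero U (p ^ 1)%N c by rewrite expn1.
have beta_cocycle := twisted_cocycle sU cM' c0'.
have beta_pred : cocycle_pred (twist theta 1) (fun u : U => of_res p 1 (c (\val u))).
  exact/asboolP.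
pose beta : Z1 U (twist theta 1) :=
  exist (fun b : U -> _ => cocycle_pred (twist theta 1) b) _ beta_pred.
have [a aE] := smooth U oU sU n (\pi_(H1 U (twist theta 1)) beta).
have := aE; rewrite -[a]reprK /H1_red H1_map_pi => /eqP.
rewrite -Quotient.idealrBE => /asboolP[m mE].
set gamma := generic_quotient.repr a in mE.
have /asboolP gammaP := svalP gamma.
exists (ext_res (sval gamma)); split.
- exact: cocycle_twisted.
- move=> g Ug; pose u : U := exist _ g (mem_set Ug).
  have := ext_resE (sval gamma) u => /= ->.
  (* The action on Z/p is trivial, so the coboundary of m is 0. *)
  have twist1 : twist theta 1 g m = m.
    rewrite -[RHS](resK p_gt0) /twist /= -{1}[m](resK p_gt0) of_res_scale.
    apply/(of_res_eqP p_gt0); rewrite expn1 -[X in _ - X]mul1r -mulrBl.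
    exact: dvdz_mulr.
  have := mE u; rewrite /= twist1 subrr => /eqP.
  rewrite -[X in X == 0]/(red_mod (sval gamma u) - of_res p 1 (c g)) subr_eq0.
  by rewrite red_resE => /eqP/(of_res_eqP p_gt0); rewrite expn1.
- by move=> t1; exact: cocycle_locally_zero.
Qed.

Lemma lift_one_smooth : (forall g, theta g = 1) ->
  (forall U n c, open U -> is_subgroup U -> hom_mod U p c -> locally_zero U p c ->
   exists C, [/\ hom_mod U (p ^ n.+1)%N C, locally_zero U (p ^ n.+1)%N C
     & forall g, U g -> (p %| C g - c g)%Z]) ->
  one_smooth theta.
Proof.
move=> theta1 lift U oU sU n b.
have [U1 UM UV] := sU.
have dvd1 k g x : ((p ^ k)%N %| digits (theta g) k * x - x)%Z.
  by rewrite theta1 -[X in _ - X]mul1r -mulrBl dvdz_mulr // dvdz_modB.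
rewrite -[b]reprK; set beta := generic_quotient.repr b.
have /asboolP beta_cocycle := svalP beta.
pose c := ext_res (sval beta).
have cM : hom_mod U p c.
  move=> x y Ux Uy; have := cocycle_twisted sU beta_cocycle Ux Uy.
  rewrite expn1 => h; have := dvd1 1%N x (c y); rewrite expn1 => /(rpredD h).
  by congr (_ %| _)%Z; rewrite /c; ring.
have c0 : locally_zero U p c.
  have := cocycle_locally_zero sU (theta1 _) beta_cocycle; rewrite expn1; exact.
have [C [CM C0 Cc]] := lift U n c oU sU cM c0.
have CM' : twisted_hom U (p ^ n.+1)%N n.+1 C.
  move=> x y Ux Uy; have := rpredB (CM x y Ux Uy) (dvd1 n.+1 x (C y)).
  by congr (_ %| _)%Z; ring.
have gamma_cocycle := twisted_cocycle sU CM' C0.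
have gamma_pred : cocycle_pred (twist theta n.+1) (fun u : U => of_res p n.+1 (C (\val u))).
  exact/asboolP.
pose gamma : Z1 U (twist theta n.+1) :=
  exist (fun b : U -> _ => cocycle_pred (twist theta n.+1) b) _ gamma_pred.
exists (\pi_(H1 U (twist theta n.+1)) gamma); rewrite /H1_red H1_map_pi.
congr (\pi_(H1 U (twist theta 1)) _); apply: val_inj; apply/funext => u /=.
rewrite red_of_res -[RHS](resK p_gt0); apply/(of_res_eqP p_gt0).
by rewrite -ext_resE expn1; apply: Cc; exact: (set_mem (valP u)).
Qed.

End Cocycles.

(** * Triviality of the orientation *)

Section CyclicLog.
Variables (p : nat) (G : topologicalGroupType) (F : finGroupType) (f : G -> F).
Hypotheses (p_pr : prime p) (fq : finite_p_quotient p f).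
Variable y : G.
Hypothesis fy : f y <> 1%g.

Let U : set G := [set g | f g \in cycle (f y)].

(** The discrete logarithm to base [f y]. It is defined modulo the order of [f y], hence modulo p,
    since that order is a nontrivial power of p. *)
Lemma cyclic_log : exists c : G -> int,
  [/\ open U, is_subgroup U, hom_mod U p c, locally_zero U p c
    & (forall g, f g = 1%g -> (p %| c g)%Z) /\ (p %| c y - 1)%Z].
Proof.
have [fM f_surj pF oker] := fq.
have [oU sU] := preimage_group <[f y]>%G fM oker.
have p_fy : (p %| #[f y]%g)%N.
  have : (p.-elt (f y))%g by exact: mem_p_elt pF (finset.in_setT _).
  case/p_natP => -[/eqP|k ->]; first by rewrite order_eq1 => /eqP.
  by rewrite expnS dvdn_mulr.
(* The exponent 0 is a default value outside U. *)
have lg g : exists i : nat, U g -> f g = (f y ^+ i)%g.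
  have [/cycleP[i fi]|] := boolP (f g \in cycle (f y)); first by exists i.
  by move=> nfg; exists 0%N => Ug; rewrite /U /= (negbTE nfg) in Ug.
have [c cE] := choice lg.
have key g i : U g -> f g = (f y ^+ i)%g -> (p %| (c g)%:Z - i%:Z)%Z.
  move=> Ug; rewrite cE // => /eqP; rewrite eq_expg_mod_order => ci.
  apply: (@dvdz_trans #[f y]%g) => //; rewrite -eqz_mod_dvd; move: ci.
  by rewrite !modz_nat eqz_nat.
exists (fun g => (c g)%:Z); split=> //.
- move=> g h Ug Uh; rewrite -PoszD; apply: key; first by case: sU => _ /(_ _ _ Ug Uh).
  by rewrite fM (cE g Ug) (cE h Uh) expgnDr.
- apply: filterS (open_nbhs_nbhs (conj oker _)) => [g fg Ug|]; last exact: morph_mulg1.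
  by have := key g 0%N Ug fg; rewrite subr0.
split; last by apply: (key y 1%N) => //; exact: cycle_id.
move=> g fg; have := key g 0%N; rewrite subr0; apply=> //.
by rewrite /U /= fg group1.
Qed.

End CyclicLog.

Section Descent.
Variables (p : nat) (G : topologicalGroupType) (theta : G -> padic p).
Hypotheses (p_pr : prime p) (smooth : one_smooth theta).
Hypothesis theta1 : forall g, exists z, theta g = 1 + z *+ p.

Lemma commuting_lift (F : finGroupType) (f : G -> F) x y n :
  finite_p_quotient p f -> commute x y -> f x = 1%g -> f y <> 1%g ->
  exists cx cy : int, [/\ (p %| cx)%Z, (p %| cy - 1)%Z &
    ((p ^ n.+1)%N %| (digits (theta x) n.+1 - 1) * cy - (digits (theta y) n.+1 - 1) * cx)%Z].
Proof.
move=> fq xyC fx fy; have [c [oU sU cM c0 [cker cy]]] := cyclic_log fq fy.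
have [C [CM Cc _]] := one_smooth_lift (prime_gt0 p_pr) n smooth theta1 oU sU cM c0.
have Ux : f x \in cycle (f y) by rewrite fx group1.
have Uy : f y \in cycle (f y) by exact: cycle_id.
exists (C x), (C y); split.
- by rewrite -(subrK (c x) (C x)); apply: rpredD (Cc x Ux) (cker x fx).
- by rewrite -(subrK (c y) (C y)) -addrA; apply: rpredD (Cc y Uy) cy.
- have := rpredB (CM y x Uy Ux) (CM x y Ux Uy); rewrite -xyC.
  by congr (_ %| _)%Z; ring.
Qed.

(** Both congruences are proved by one induction on the exponent m: each element gains a factor p
    from what the other has already reached. *)
Lemma commuting_descent (F F' : finGroupType) (f : G -> F) (f' : G -> F') x y :
  finite_p_quotient p f -> finite_p_quotient p f' -> commute x y ->
  f x = 1%g -> f y <> 1%g -> f' y = 1%g -> f' x <> 1%g -> theta x = 1 /\ theta y = 1.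
Proof.
move=> fq fq' xyC fx fy f'y f'x; have p_gt0 := prime_gt0 p_pr.
(* theta h - 1 brings p^m and [cg] brings one more p, while [ch] is prime to p and can be
   cancelled. *)
have step g h m (cg ch : int) : (p %| cg)%Z -> (p %| ch - 1)%Z ->
    ((p ^ m.+1)%N %| (digits (theta g) m.+1 - 1) * ch - (digits (theta h) m.+1 - 1) * cg)%Z ->
    ((p ^ m)%N %| digits (theta h) m - 1)%Z -> ((p ^ m.+1)%N %| digits (theta g) m.+1 - 1)%Z.
  move=> pcg pch E h1.
  have h2 : ((p ^ m)%N %| digits (theta h) m.+1 - 1)%Z.
    have := digits_le (theta h) m 1; rewrite addn1 => /rpredD/(_ h1).
    by congr (_ %| _)%Z; ring.
  have : ((p ^ m.+1)%N %| (digits (theta g) m.+1 - 1) * ch)%Z.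
    rewrite -(subrK ((digits (theta h) m.+1 - 1) * cg) (_ * ch)).
    by apply: rpredD E _; rewrite expnSr PoszM dvdz_mul.
  rewrite Gauss_dvdzl // coprimezE /= coprimeXl // prime_coprime //.
  apply/negP => pch'.
  have : (p %| ch - (ch - 1))%Z by apply: rpredB.
  rewrite subKr.
  by rewrite dvdz1 => /eqP p1; move: p_pr; rewrite -[p]absz_nat p1.
have main m : ((p ^ m)%N %| digits (theta x) m - 1)%Z /\ ((p ^ m)%N %| digits (theta y) m - 1)%Z.
  elim: m => [|m [IHx IHy]]; first by rewrite !dvd1z.
  have [a [b [pa pb ab]]] := commuting_lift m fq xyC fx fy.
  have [a' [b' [pa' pb' ab']]] := commuting_lift m fq' (commute_sym xyC) f'y f'x.
  by split; [exact: step ab IHy|exact: step ab' IHx].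
have conc g : (forall m, ((p ^ m)%N %| digits (theta g) m - 1)%Z) -> theta g = 1.
  move=> h; apply: padic_eqP => n; rewrite -[digits 1 n]/(1 %% (p ^ n)%N)%Z.
  by rewrite -(subrKA 1%Z); apply: rpredD (h n) _; rewrite -rpredN opprB; exact: dvdz_modB.
by split; apply: conc => m; case: (main m).
Qed.

End Descent.

(** * Lifting characters and torsion in abelianizations *)

(** Closure under inverses comes for free in a finite group. *)
Lemma image_group (G : groupType) (F : finGroupType) (phi : G -> F) (R : G -> Prop) :
  {morph phi : x y / (x * y)%g} -> R 1%g -> (forall x y, R x -> R y -> R (x * y)%g) ->
  exists D : {group F}, forall s, s \in D <-> exists2 h, R h & phi h = s.
Proof.
move=> phiM R1 RM.
pose im := finset (fun s => `[< exists2 h, R h & phi h = s >]).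
have imP s : s \in im <-> exists2 h, R h & phi h = s.
  by rewrite finset.inE; split=> /asboolP.
suff im_group : group_set im by exists (group im_group).
apply/group_setP; split.
  by apply/imP; exists 1%g => //; exact: morph_mulg1.
move=> _ _ /imP[g Rg <-] /imP[h Rh <-]; apply/imP.
by exists (g * h)%g; [exact: RM|exact: phiM].
Qed.

Section Characters.
Variables (p : nat) (G : topologicalGroupType).
Hypothesis p_pr : prime p.

Definition character (U : set G) (m : nat) (chi : G -> int) :=
  hom_mod U m chi /\ locally_zero U m chi.

(** 1-smoothness for trivial theta without cohomology: H^1 is then a group of continuous
    homomorphisms. *)
Definition character_lifting := forall (U : set G) (n : nat) (c : G -> int),
  open U -> is_subgroup U -> character U p c ->
  exists2 C, character U (p ^ n.+1)%N C & forall g, U g -> (p %| C g - c g)%Z.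

Let character_ker (U : set G) m (chi : G -> int) := [set g | U g /\ (m %| chi g)%Z].

Lemma character_ker_subgroup (U : set G) m chi : is_subgroup U ->
  character U m chi -> is_subgroup (character_ker U m chi).
Proof.
move=> [U1 UM UV] [chiM chi0].
split=> [|g h [Ug cg] [Uh ch]|g [Ug cg]].
- by split=> //; exact: hom_mod1 chiM.
- split; first exact: UM.
  rewrite -(subrK (chi g + chi h) (chi _)); apply: rpredD; first exact: chiM.
  exact: rpredD.
- split; first exact: UV.
  rewrite -(addrK (chi g) (chi _)); apply: rpredB cg.
  exact: hom_modV chiM _ Ug.
Qed.

Lemma character_ker_open (U : set G) m chi : open U -> is_subgroup U ->
  character U m chi -> open (character_ker U m chi).
Proof.
move=> oU sU chiP; apply: subgroup_open; first exact: character_ker_subgroup.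
have U1 : nbhs (1%g : G) U by apply: open_nbhs_nbhs; split=> //; case: sU.
by case: chiP => _ chi0; apply: filterS2 chi0 U1 => g cg Ug; split=> //; exact: cg.
Qed.

Lemma character_commutator (U : set G) m chi y : open U -> is_subgroup U ->
  character U m chi -> closed_commutator U y -> (m %| chi y)%Z.
Proof.
move=> oU sU chiP; have [U1 UM UV] := sU; have [chiM _] := chiP.
have sR := character_ker_subgroup sU chiP.
have cR := open_subgroup_closed sR (character_ker_open oU sU chiP).
by case/(closed_commutator_min cR sR) => // x z Ux Uz; split;
  [exact: subgR|exact: hom_modR chiM _ _ Ux Uz].
Qed.

(** Induction on r. A character modulo p^(r+1) is compared with a deep lift C of its reduction
    modulo p: C kills y modulo p^(r+1), and the difference is p times a character modulo p^r. *)
Lemma character_torsion (U : set G) y n : character_lifting -> open U ->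
  is_subgroup U -> U y -> (0 < n)%N -> closed_commutator U (y ^+ n)%g ->
  forall r chi, character U (p ^ r)%N chi -> ((p ^ r)%N %| chi y)%Z.
Proof.
move=> lift oU sU Uy n0 cyn; have [U1 UM UV] := sU.
elim=> [|r IHr] chi chiP; first by rewrite dvd1z.
have dvd_p : (p %| (p ^ r.+1)%N%:Z)%Z by rewrite expnS PoszM dvdz_mulr.
have chip : character U p chi.
  case: chiP => chiM chi0; split=> [g h Ug Uh|].
    exact: dvdz_trans dvd_p (chiM g h Ug Uh).
  by apply: filterS chi0 => g cg Ug; exact: dvdz_trans dvd_p (cg Ug).
(* The relation n C(y) = 0 loses s factors p, so the lift is taken modulo p^(r+1+s). *)
pose s := logn p n.
have [C CP Cchi] := lift U (r + s)%N chi oU sU chip.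
have [CM C0] := CP; have [chiM chi0] := chiP.
have Cy : ((p ^ r.+1)%N %| C y)%Z.
  have := rpredB (character_commutator oU sU CP cyn) (hom_modX U1 UM CM n Uy).
  rewrite subKr; have [n' pn' nE] := pfactor_coprime p_pr n0.
  have -> : (n%:Z * C y = (p ^ s)%N%:Z * (n'%:Z * C y))%R by rewrite nE PoszM; ring.
  rewrite -addSn addnC expnD PoszM dvdz_mul2l; last by rewrite -lt0n expn_gt0 prime_gt0.
  by rewrite Gauss_dvdzr // coprimezE /= coprimeXl.
have dvd_rs : ((p ^ r.+1)%N %| (p ^ (r + s).+1)%N%:Z)%Z by rewrite -addSn expnD PoszM dvdz_mulr.
pose chi1 g := ((chi g - C g) %/ p)%Z.
have chi1E g : U g -> (chi g - C g = p%:Z * chi1 g)%R.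
  by move=> Ug; rewrite mulrC divzK // -opprB rpredN; exact: Cchi.
have p0 : p%:Z != 0 by rewrite -lt0n prime_gt0.
have chi1P : character U (p ^ r)%N chi1.
  split=> [g h Ug Uh|].
    rewrite -(@dvdz_mul2l p%:Z) // -PoszM -expnS mulrBr mulrDr -!chi1E //; last exact: UM.
    have := rpredB (chiM g h Ug Uh) (dvdz_trans dvd_rs (CM g h Ug Uh)).
    by congr (_ %| _)%Z; ring.
  apply: filterS2 chi0 C0 => g cg Cg Ug.
  rewrite -(@dvdz_mul2l p%:Z) // -PoszM -expnS -chi1E //.
  by apply: rpredB; [exact: cg|exact: dvdz_trans dvd_rs (Cg Ug)].
rewrite -(subrK (C y) (chi y)); apply: rpredD Cy; rewrite chi1E // expnS PoszM.
by rewrite dvdz_mul2l // IHr.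
Qed.

(** Membership in the closure is tested in finite quotients: if the image of y escaped the derived
    subgroup of the image D of H, a character of D modulo #|D| would detect it, against
    [character_torsion]. *)
Lemma lifting_absolutely_torsion_free : is_pro_p G p -> character_lifting ->
  absolutely_torsion_free G.
Proof.
move=> proG lift H cH sH y n Hy n0 cyn A yA.
pose S := smallest (@is_subgroup G) [set [~ x, z]%g | x in H & z in H].
have sS : is_subgroup S by exact: smallest_is_subgroup.
have [H1 HM HV] := sH; have [S1 SM SV] := sS.
have : nbhs (1%g : G) [set z | A (y * z)%g] by apply: nbhs_lmulg; rewrite mulg1.
move=> /(pro_p_separation proG p_pr)[F [phi [phiq phiA]]].
have [phiM phi_surj pF oker] := phiq.
have [D DP] := image_group phiM H1 HM; have [E EP] := image_group phiM S1 SM.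
have DE : (D^`(1) \subset E)%g.
  rewrite derg1 gen_subG; apply/fintype.subsetP => _ /imset2P[_ _ /DP[g Hg <-] /DP[h Hh <-] ->].
  apply/EP; exists [~ g, h]%g; last exact: morph_mulgR.
  by apply: sub_gen_smallest; exists g => //; exists h.
suff /(fintype.subsetP DE)/EP[h Sh hy] : phi y \in (D^`(1))%g.
  exists h; split=> //; rewrite -(mulKVg y h); apply: phiA.
  by rewrite phiM morph_mulgV // hy mulVg.
have Dy : phi y \in D by apply/DP; exists y.
apply: contraT => nDy.
(* An open subgroup containing H, with the same image D: the torsion relation for y in H persists in
   U. *)
pose U := phi @^-1` (fun s => s \in D).
have [oU sU] := preimage_group D phiM oker.
have HU : H `<=` U by move=> h Hh; apply/DP; exists h.
have [r Dr] : exists r, #|D| = (p ^ r)%N.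
  have : (p.-group D)%g by exact: pgroupS (finset.subsetT _) pF.
  by case/p_natP => r ->; exists r.
have [chi [chiM /negP[]]] := hom_mod_separation (esym Dr) Dy nDy.
apply: (@character_torsion U y n lift oU sU Dy n0 _ r (chi \o phi)).
  exact: closed_commutatorS cyn.
split=> [g h Ug Uh|]; first by rewrite /= phiM; exact: chiM.
apply: filterS (open_nbhs_nbhs (conj oker _)) => [g fg _ /=|]; last exact: morph_mulg1.
by rewrite fg; exact: hom_mod1 (group1 D) chiM.
Qed.

End Characters.

(** * Powers modulo the closed commutator subgroup *)

Section PowersModCommutator.
Local Open Scope group_scope.
Variables (G : topologicalGroupType) (U : set G).
Hypotheses (cU : closed U) (sU : is_subgroup U).
Let C := closed_commutator U.

Lemma expgMn_mod_commutator a b n : U a -> U b ->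
  C (((a * b) ^+ n)^-1 * (a ^+ n * b ^+ n)).
Proof.
move=> Ua Ub; have [_ UM UV] := sU.
have [C1 CM CV] := closed_commutator_subgroup U.
elim: n => [|n IHn]; first by rewrite !expg0 invg1 !mul1g.
rewrite expgSr (expgSr a) (expgSr b).
set w := (a * b) ^+ n in IHn *; set x := a ^+ n in IHn *; set y := b ^+ n in IHn *.
have -> : (w * (a * b))^-1 * (x * a * (y * b)) = ((w^-1 * (x * y)) ^ a * [~ a, y]) ^ b.
  rewrite !conjgE commgEl !conjgE !invgM !mulgA; do ?rewrite ?mulgK ?mulgVK.
  by [].
apply: closed_commutatorJ => //; apply: CM; first exact: closed_commutatorJ.
by apply: closed_commutator_comm => //; exact: subgX.
Qed.

(* [power_class q x g]: g and x ^+ q have the same image in U / C *)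
Definition power_class q x g := C ((x ^+ q)^-1 * g).

Lemma power_class_expg q x : power_class q x (x ^+ q).
Proof. by rewrite /power_class mulVg; case: (closed_commutator_subgroup U). Qed.

Lemma power_class1 q g : C g -> power_class q 1 g.
Proof. by rewrite /power_class expg1n invg1 mul1g. Qed.

Lemma power_class_mem q x g : U x -> power_class q x g -> U g.
Proof.
move=> Ux /(closed_commutator_le cU sU) Uxg; apply: (subgMl sU _ Uxg).
by have [_ _ UV] := sU; apply: UV; exact: subgX.
Qed.

Lemma power_classM q x y g h : U x -> U y ->
  power_class q x g -> power_class q y h -> power_class q (x * y) (g * h).
Proof.
move=> Ux Uy Cg Ch; have [_ CM _] := closed_commutator_subgroup U.
rewrite /power_class; have -> : ((x * y) ^+ q)^-1 * (g * h) =
  (((x * y) ^+ q)^-1 * (x ^+ q * y ^+ q)) *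
  (((x ^+ q)^-1 * g) ^ (y ^+ q) * ((y ^+ q)^-1 * h)).
  by rewrite conjgE !mulgA; do ?rewrite ?mulgK ?mulgVK.
apply: (CM); first exact: expgMn_mod_commutator.
by apply: CM => //; apply: closed_commutatorJ => //; exact: subgX.
Qed.

Lemma power_classV q x g : U x -> power_class q x g -> power_class q x^-1 g^-1.
Proof.
move=> Ux Cg; have [_ _ CV] := closed_commutator_subgroup U; have [_ _ UV] := sU.
rewrite /power_class; have -> : ((x^-1) ^+ q)^-1 * g^-1 = ((x ^+ q)^-1 * g)^-1 ^ (x ^+ q)^-1.
  by rewrite expVgn conjgE !invgM !invgK !mulgA; do ?rewrite ?mulgK ?mulgVK.
by apply: closed_commutatorJ => //; [exact: CV|by apply: (UV); exact: subgX].
Qed.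

End PowersModCommutator.

Section Lifting.
Variables (p : nat) (G : topologicalGroupType).
Hypotheses (p_pr : prime p) (proG : is_pro_p G p).

Lemma absolutely_torsion_free_lifting :
  absolutely_torsion_free G -> character_lifting p G.
Proof.
move=> atf U n c oU sU cP; have [cM c0] := cP; have [U1 UM UV] := sU.
have [cG hG _ _] := proG.
have cU : closed U by exact: open_subgroup_closed.
have p_gt0 := prime_gt0 p_pr.
set q := (p ^ n)%N; have q_gt0 : (0 < q)%N by rewrite expn_gt0 p_gt0.
pose C0 := closed_commutator U.
pose P := @power_class G U q.
pose S := U `\` [set g | U g /\ (p %| c g)%Z].
have cptS : compact S.
  apply: (subclosed_compact _ cG) => //; apply: closedI => //.
  exact/open_closedC/character_ker_open.
have cptC : compact C0 by apply: (subclosed_compact _ cG) => //; exact: closed_closure.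
(* T avoids 1 by torsion-freeness, so a quotient phi can avoid T; then
   phi (x ^+ q * k) |-> p ^ n * c x is well defined, and any extension of it
   to phi U is a lift of c *)
pose T := (fun u : G * G => (u.1 ^+ q * u.2)%g) @` (S `*` C0).
have TP x g : S x -> P x g -> T g.
  by move=> Sx Pxg; exists (x, ((x ^+ q)^-1 * g)%g) => //=; rewrite mulKVg.
have clT : closed T.
  apply: (compact_closed hG); apply: continuous_compact; last exact: compact_setX.
  apply: continuous_subspaceT; apply: continuousMg; last by move=> u; exact: cvg_snd.
  by apply: continuousXg => u; exact: cvg_fst.
have T1 : ~ T 1%g.
  case=> -[x k] /= [[Ux /not_andP[//|cx]] Ck] xk; apply: cx.
  apply: (character_commutator oU sU cP); apply: (atf U cU sU x q Ux q_gt0).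
  have [_ _ CV] := closed_commutator_subgroup U.
  have -> : (x ^+ q)%g = (k^-1)%g by apply: (mulIg k); rewrite xk mulVg.
  exact: CV.
have : nbhs (1%g : G) (~` T) by apply: open_nbhs_nbhs; split=> //; exact: closed_openC.
move=> /(pro_p_separation proG p_pr)[F [phi [phiq phiT]]].
have [phiM phi_surj pF oker] := phiq.
have [D DP] := image_group phiM U1 UM.
(* The elements of U that are q-th powers modulo its closed commutator subgroup: a subgroup, since U
   modulo it is abelian. The lift is prescribed on its image B. *)
pose R : set G := [set g | exists2 x, U x & P x g].
have sR : is_subgroup R.
  split=> [|g h [x Ux xg] [y Uy yh]|g [x Ux xg]].
  - exists 1%g => //; apply: power_class1.
    by case: (closed_commutator_subgroup U).
  - by exists (x * y)%g; [exact: UM|exact: power_classM].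
  - by exists x^-1%g; [exact: UV|exact: power_classV].
have [B BP] := let: And3 R1 RM _ := sR in image_group phiM R1 RM.
have root s : exists x, s \in B -> U x /\ exists2 g, P x g & phi g = s.
  have [/BP[g [x Ux xg] gs]|_] := boolP (s \in B); last by exists 1%g.
  by exists x => _; split=> //; exists g.
have [rt rtP] := choice root.
(* If two roots of s had different c modulo p, their quotient would lie in S, and its q-th power
   class would give an element of T killed by phi. *)
have key s x g : U x -> P x g -> phi g = s -> (p %| c (rt s) - c x)%Z.
  move=> Ux xg gs; have Bs : s \in B by apply/BP; exists g => //; exists x.
  have [Uy [h yh hs]] := rtP s Bs; move: (rt s) Uy yh => y Uy yh.
  have Pxy : P (x^-1 * y)%g (g^-1 * h)%g by apply: power_classM => //;
    [exact: UV|exact: power_classV].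
  have Uxy : U (x^-1 * y)%g by apply: UM => //; exact: UV.
  have : (p %| c (x^-1 * y)%g)%Z.
    apply: contrapT => cxy; apply: (phiT (g^-1 * h)%g); last first.
      by apply: TP Pxy; split=> // -[].
    by rewrite phiM morph_mulgV // gs hs mulVg.
  have := cM _ _ (UV _ Ux) Uy; have := hom_modV U1 UV cM Ux => h1 h2 h3.
  have -> : c y - c x = c (x^-1 * y)%g - (c (x^-1 * y)%g - (c x^-1%g + c y))
     - (c x^-1%g + c x) by ring.
  by do 2!apply: rpredB => //.
pose f s := (p ^ n)%N%:Z * c (rt s).
have fkey s x g : U x -> P x g -> phi g = s -> ((p ^ n.+1)%N %| f s - (p ^ n)%N%:Z * c x)%Z.
  by move=> Ux xg gs; rewrite /f -mulrBr expnSr PoszM dvdz_mul //; exact: key gs.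
have dvd_q a : (p %| a)%Z -> ((p ^ n.+1)%N %| (p ^ n)%N%:Z * a)%Z.
  by move=> pa; rewrite expnSr PoszM dvdz_mul.
have [C1 CM _] := closed_commutator_subgroup U.
have [E EP] := image_group phiM C1 CM.
have DE : (D^`(1) \subset E)%g.
  rewrite derg1 gen_subG; apply/fintype.subsetP => _ /imset2P[_ _ /DP[g Ug <-] /DP[h Uh <-] ->].
  apply/EP; exists [~ g, h]%g; last exact: morph_mulgR.
  exact: closed_commutator_comm.
have EB s : s \in E -> s \in B /\ ((p ^ n.+1)%N %| f s)%Z.
  move=> /EP[k Ck ks]; have Pk : P 1%g k by exact: power_class1.
  split; first by apply/BP; exists k => //; exists 1%g.
  rewrite -(subrK ((p ^ n)%N%:Z * c 1%g) (f s)); apply: rpredD (fkey _ _ _ U1 Pk ks) _.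
  by apply: dvd_q; exact: hom_mod1 U1 cM.
have [||||||chi [chiM chif]] := @hom_mod_extend F D (p ^ n.+1)%N B f.
- by rewrite expn_gt0 p_gt0.
- apply/fintype.subsetP => _ /BP[g [x Ux xg] <-]; apply/DP; exists g => //.
  exact: power_class_mem xg.
- by apply/fintype.subsetP => s /(fintype.subsetP DE)/EB[].
- move=> s t Bs Bt; have [Ux [g xg gs]] := rtP s Bs; have [Uy [h yh ht]] := rtP t Bt.
  have := fkey (s * t)%g (rt s * rt t)%g (g * h)%g (UM _ _ Ux Uy) (power_classM cU sU Ux Uy xg yh).
  rewrite phiM gs ht => /(_ erefl) /rpredD/(_ (dvd_q _ (cM _ _ Ux Uy))).
  by congr (_ %| _)%Z; rewrite /f; ring.
- by move=> s /(fintype.subsetP DE)/EB[].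
(* g^(p^(n+1)) is the q-th power of g^p, and c (g^p) is p c g modulo p, hence 0: the prescribed
   value vanishes on p^(n+1)-th powers. *)
- move=> _ /DP[g Ug <-].
  have Ugp : U (g ^+ p)%g by exact: subgX.
  have Pg : P (g ^+ p)%g (g ^+ (p ^ n.+1)%N)%g by rewrite expnS expgnA; exact: power_class_expg.
  split; first by apply/BP; exists (g ^+ (p ^ n.+1))%g; [exists (g ^+ p)%g|exact: morph_mulgX].
  rewrite -(subrK ((p ^ n)%N%:Z * c (g ^+ p)%g) (f _)); apply: rpredD.
    by apply: fkey Pg _ => //; exact: morph_mulgX.
  apply: dvd_q; rewrite -(subrK (p%:Z * c g) (c _)); apply: rpredD (hom_modX U1 UM cM p Ug) _.
  exact: dvdz_mulr.
exists (chi \o phi).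
  split=> [g h Ug Uh|].
    by rewrite /= phiM; apply: chiM; apply/DP; [exists g|exists h].
  apply: filterS (open_nbhs_nbhs (conj oker _)) => [g fg _ /=|]; last exact: morph_mulg1.
  by rewrite fg; exact: hom_mod1 (group1 D) chiM.
move=> g Ug /=.
have Dg : phi g \in D by apply/DP; exists g.
have Pg : P g (g ^+ q)%g by exact: power_class_expg.
have Bg : phi (g ^+ q)%g \in B by apply/BP; exists (g ^+ q)%g => //; exists g.
(* Modulo p^(n+1), q chi (phi g) and p^n c g both agree with the value of chi at phi (g^q);
   cancelling p^n leaves the congruence modulo p. *)
have := rpredD (chif _ Bg) (fkey _ _ _ Ug Pg erefl).
rewrite morph_mulgX // => /(rpredB)/(_ (hom_modX (group1 D) (@groupM _ D) chiM q Dg)).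
have -> : chi (phi g ^+ q)%g - f (phi g ^+ q)%g + (f (phi g ^+ q)%g - (p ^ n)%N%:Z * c g) -
  (chi (phi g ^+ q)%g - q%:Z * chi (phi g)) = (p ^ n)%N%:Z * (chi (phi g) - c g).
  by rewrite /q; ring.
by rewrite expnSr PoszM dvdz_mul2l // -lt0n.
Qed.

End Lifting.

(** * Direct products *)

Section Transfer.
Local Open Scope group_scope.
Variables G K : topologicalGroupType.

Lemma closed_commutator_morph (f : G -> K) (H : set G) (H' : set K) :
  continuous f -> {morph f : x y / x * y} -> (forall x, H x -> H' (f x)) ->
  forall x, closed_commutator H x -> closed_commutator H' (f x).
Proof.
move=> fc fM HH'; have [C1 CM CV] := closed_commutator_subgroup H'.
apply: (@closed_commutator_min _ H (f @^-1` closed_commutator H')).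
- by apply: preimage_closed => //; exact: closed_closure.
- by split=> [|x y Cx Cy|x Cx]; rewrite /preimage /= ?morph_mulg1 ?fM ?morph_mulgV //;
    [exact: CM|exact: CV].
- move=> x y /HH' Hx /HH' Hy; rewrite /preimage /= morph_mulgR //.
  exact: closed_commutator_comm.
Qed.

End Transfer.

Section Images.
Local Open Scope group_scope.
Variables G K : topologicalGroupType.

Lemma image_closed_subgroup (f : G -> K) (H : set G) :
  continuous f -> {morph f : x y / x * y} -> compact [set: G] -> hausdorff_space K ->
  closed H -> is_subgroup H -> closed (f @` H) /\ is_subgroup (f @` H).
Proof.
move=> fc fM cG hK cH [H1 HM HV]; split.
  apply: (compact_closed hK); apply: continuous_compact; first exact: continuous_subspaceT.
  exact: (subclosed_compact cH cG).
split=> [|_ _ [x Hx <-] [y Hy <-]|_ [x Hx <-]].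
- by exists 1 => //; exact: morph_mulg1.
- by exists (x * y); [exact: HM|exact: fM].
- by exists x^-1; [exact: HV|exact: morph_mulgV].
Qed.

(** The retraction g brings the closed commutator subgroup of f(H) back into that of H. Applied to
    the two axes of a product. *)
Lemma absolutely_torsion_free_retract (f : G -> K) (g : K -> G) :
  continuous f -> continuous g -> {morph f : x y / x * y} -> {morph g : x y / x * y} ->
  cancel f g -> compact [set: G] -> hausdorff_space K ->
  absolutely_torsion_free K -> absolutely_torsion_free G.
Proof.
move=> fc gc fM gM fK cG hK atf H cH sH y n Hy n0 cyn.
have [cfH sfH] := image_closed_subgroup fc fM cG hK cH sH.
rewrite -[y]fK; apply: (closed_commutator_morph (H := f @` H) gc gM).
  by move=> _ [x Hx <-]; rewrite fK.
apply: (atf _ cfH sfH (f y) n _ n0 _); first by exists y.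
rewrite -morph_mulgX //; apply: closed_commutator_morph cyn; [by []|by []|move=> x Hx].
by exists x.
Qed.

Lemma commutative_torsion_free : hausdorff_space G -> (forall x y : G, x * y = y * x) ->
  absolutely_torsion_free G -> torsion_free_abelian G.
Proof.
move=> hG GC atf; split=> // x n n0 xn.
have c1 : closed [set (1 : G)].
  by apply: accessible_closed_set1; exact: hausdorff_accessible.
have C1 : closed_commutator [set: G] `<=` [set 1].
  apply: closed_commutator_min => //.
    by split=> [|_ _ -> ->|_ ->] //=; rewrite ?mulg1 ?invg1.
  by move=> u v _ _; apply/eqP/commgP; exact: GC.
apply: C1; apply: (atf setT closedT _ x n _ n0 _) => //.
by rewrite xn; case: (closed_commutator_subgroup [set: G]).
Qed.

End Images.

Section Products.
Local Open Scope group_scope.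

(** Two jointly injective morphisms replace the projections, so that exchanging [fst] and [snd]
    settles both orders of the factors. Torsion dies in A, and in B it is lifted back to a k in the
    closed commutator subgroup of H with the same coordinates as y. *)
Lemma absolutely_torsion_free_prod (K A B : topologicalGroupType)
    (f : K -> A) (g : K -> B) :
  continuous f -> continuous g -> {morph f : x y / x * y} -> {morph g : x y / x * y} ->
  (forall x y, f x = f y -> g x = g y -> x = y) -> compact [set: K] ->
  hausdorff_space A -> hausdorff_space B ->
  torsion_free_abelian A -> absolutely_torsion_free B -> absolutely_torsion_free K.
Proof.
move=> fc gc fM gM fg_inj cK hA hB [AC Atf] atf H cH sH y n Hy n0 cyn.
have sC := closed_commutator_subgroup H.
have fC x : closed_commutator H x -> f x = 1.
  apply: (@closed_commutator_min _ H (f @^-1` [set 1])).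
  - apply: preimage_closed => //; apply: accessible_closed_set1.
    exact: hausdorff_accessible.
  - by split=> [|u v /= fu fv|u /= fu];
      rewrite /preimage /= ?morph_mulg1 ?fM ?morph_mulgV // ?fu ?fv ?mulg1 ?invg1.
  - by move=> u v _ _; rewrite /preimage /= morph_mulgR //; apply/eqP/commgP; exact: AC.
have fy : f y = 1 by apply: (Atf _ n n0); rewrite -morph_mulgX // fC.
have [cgH sgH] := image_closed_subgroup gc gM cK hB cH sH.
have [cgC sgC] := image_closed_subgroup gc gM cK hB (@closed_closure _ _) sC.
have : closed_commutator (g @` H) (g y).
  apply: (atf _ cgH sgH (g y) n _ n0 _); first by exists y.
  rewrite -morph_mulgX //; apply: closed_commutator_morph cyn; [by []|by []|move=> x Hx].
  by exists x.
(* Compactness makes the image of the closed commutator subgroup closed, so it absorbs the limits of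
   commutators of g(H). *)
have sub : closed_commutator (g @` H) `<=` g @` closed_commutator H.
  apply: closed_commutator_min => // _ _ [u Hu <-] [v Hv <-].
  by exists [~ u, v]; [exact: closed_commutator_comm|exact: morph_mulgR].
case/sub => k Ck gk; rewrite -(fg_inj k y) // fy; exact: fC.
Qed.

Lemma der1_gen_sub (gT : finGroupType) (S : {set gT}) (R : {group gT}) :
  <<S>> \subset 'N(R) -> (forall a b, a \in S -> b \in S -> [~ a, b] \in R) ->
  <<S>>^`(1) \subset R.
Proof.
move=> nR SR; apply: der1_min => //.
have nSR : S \subset 'N(R) by rewrite gen_subG in nR.
rewrite quotient_gen // abelian_gen.
apply/centsP => _ /morphimP[a nRa Sa ->] _ /morphimP[b nRb Sb ->].
by apply/commgP; rewrite -morphR //; apply/eqP/coset_id/SR.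
Qed.

End Products.

(** * Torsion from two noncommutative factors *)

Section TwoNonabelianFactors.
Local Open Scope group_scope.
Variables (p : nat) (G1 G2 : topologicalGroupType).
Hypotheses (p_pr : prime p) (proG1 : is_pro_p G1 p) (proG2 : is_pro_p G2 p).

Lemma commgMJ (G : groupType) (u v y : G) : [~ u * v, y] = [~ u, y] ^ v * [~ v, y].
Proof.
by rewrite !commgEl !conjgE !invgM !mulgA; do ?rewrite ?mulgK ?mulgVK.
Qed.

(** Bilinearity of commutators, using only (x, z) in U and not (x, 1): on an element with trivial
    second coordinate, conjugation by (x, z) is conjugation by x in the first one. *)
Lemma commXg_mod_commutator (U : set (G1 * G2)) (x y : G1) (z : G2) n :
  closed U -> is_subgroup U -> U (x, z) -> U ([~ x, y], 1) ->
  closed_commutator U (([~ x ^+ n, y], 1)^-1 * ([~ x, y], 1) ^+ n).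
Proof.
move=> cU sU Ux Ua; have [C1 CM CV] := closed_commutator_subgroup U.
have [U1 UM UV] := sU.
suff : U ([~ x ^+ n, y], 1) /\
    closed_commutator U (([~ x ^+ n, y], 1)^-1 * ([~ x, y], 1) ^+ n) by case.
elim: n => [|n [Ub IHn]].
  by rewrite !expg0 comm1g; split=> //; rewrite mulg1 -[(1, 1)]/(1 : G1 * G2) invg1.
have bE : (([~ x ^+ n.+1, y], 1) : G1 * G2) = ([~ x ^+ n, y], 1) ^ (x, z) * ([~ x, y], 1).
  have -> : (([~ x ^+ n, y], 1) : G1 * G2) ^ (x, z) = ([~ x ^+ n, y] ^ x, 1 ^ z) by [].
  by rewrite expgSr commgMJ mulg_pairE /= conj1g mulg1.
split; first by rewrite bE; apply: UM => //; exact: subgJ.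
rewrite bE; set a := (([~ x, y], 1) : G1 * G2) in Ua IHn *.
set b := (([~ x ^+ n, y], 1) : G1 * G2) in Ub IHn *.
have -> : (b ^ (x, z) * a)^-1 * a ^+ n.+1 = ([~ (x, z), b] * (b^-1 * a ^+ n)) ^ a.
  rewrite expgSr commgEl !conjgE !invgM !invgK !mulgA; do ?rewrite ?mulgK ?mulgVK.
  by [].
apply: closed_commutatorJ => //; apply: CM => //.
exact: closed_commutator_comm.
Qed.

Lemma product_commutative :
  absolutely_torsion_free (G1 * G2)%type ->
  (forall x y : G1, x * y = y * x) \/ (forall z w : G2, z * w = w * z).
Proof.
move=> atf; apply: contrapT => /not_orP[/existsNP[x /existsNP[y xy]] /existsNP[z /existsNP[w zw]]].
have [F1 [f1 [f1q t1 tp tC]]] := pro_p_separate_central p_pr proG1 (introN commgP xy).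
have [F2 [f2 [f2q s1 sp sC]]] := pro_p_separate_central p_pr proG2 (introN commgP zw).
have [f1M _ _ oker1] := f1q; have [f2M _ _ oker2] := f2q.
pose f (u : G1 * G2) : F1 * F2 := (f1 u.1, f2 u.2).
have fM : {morph f : u v / u * v} by move=> u v; rewrite /f f1M f2M.
have fX (u : G1 * G2) n : f (u ^+ n) = f u ^+ n by exact: morph_mulgX.
pose a : G1 * G2 := ([~ x, y], 1).
pose S := [set f (x, z); f (y, w); f a; f (x ^+ p, 1)]%SET.
pose c := f ([~ x, y], [~ z, w]).
have cC u : commute c (f u).
  have e1 : f1 [~ x, y] * f1 u.1 = f1 u.1 * f1 [~ x, y] by exact: tC.
  have e2 : f2 [~ z, w] * f2 u.2 = f2 u.2 * f2 [~ z, w] by exact: sC.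
  by rewrite /commute /f /c /f /=; congr (_, _).
have aC u : commute (f a) (f u).
  have e1 : f1 [~ x, y] * f1 u.1 = f1 u.1 * f1 [~ x, y] by exact: tC.
  by rewrite /commute -!fM /f /a /= (f1M [~ x, y]) (f1M u.1) e1 mul1g mulg1.
have XYc : [~ f (x, z), f (y, w)] = c by rewrite -morph_mulgR.
have XZ : commute (f (x, z)) (f (x ^+ p, 1)).
  rewrite /commute -!fM; congr f; rewrite !mulg_pairE /= mulg1 mul1g.
  by rewrite -expgS expgSr.
(* In the quotient [x, y] is central of order p, so [x^p, y] = [x, y]^p = 1. *)
have YZ : commute (f (y, w)) (f (x ^+ p, 1)).
  have /eqP/commgP e1 : [~ f1 x ^+ p, f1 y] = 1.
    have xyC : commute (f1 x) [~ f1 x, f1 y].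
      by apply: commute_sym; rewrite -morph_mulgR.
    by rewrite commXg // -morph_mulgR.
  rewrite /commute -!fM /f /= !f1M morph_mulgX // mulg1 mul1g.
  by congr (_, _); exact: commute_sym.
have inR g h : commute g h -> [~ g, h] \in <[c]>.
  by move=> /commgP/eqP ->; exact: group1.
have SP s : s \in S -> [\/ s = f (x, z), s = f (y, w), s = f a | s = f (x ^+ p, 1)].
  rewrite !finset.inE -!orbA => /or4P[] /eqP;
    first [exact: Or41|exact: Or42|exact: Or43|exact: Or44].
(* The only two generators that fail to commute are the images of (x, z) and (y, w), and their
   commutator c is central. *)
have SR : <<S>>^`(1) \subset <[c]>.
  apply: der1_gen_sub.
    rewrite gen_subG; apply: fintype.subset_trans (cent_sub _).
    rewrite cent_cycle; apply/fintype.subsetP => s /SP[] ->; apply/cent1P; exact/commute_sym/cC.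
  move=> g h /SP gS /SP hS.
  have inR' u v : [~ u, v] \in <[c]> -> [~ v, u] \in <[c]> by rewrite -groupV invgR.
  have inRc : [~ f (x, z), f (y, w)] \in <[c]> by rewrite XYc cycle_id.
  case: gS => ->; case: hS => ->; first [exact: inR' inRc|exact: inRc
    |apply: inR; first [exact: aC|exact/commute_sym/aC|exact: XZ|exact/commute_sym/XZ
    |exact: YZ|exact/commute_sym/YZ|by []]].
have oker : open [set u | f u = 1].
  have -> : [set u | f u = 1] = [set u | f1 u.1 = 1] `&` [set u | f2 u.2 = 1].
    by apply/seteqP; split=> u; [case=> u1 u2|case=> /= u1 u2; rewrite /= /f u1 u2].
  apply: openI; first by apply: open_comp oker1 => u _; exact: cvg_fst.
  by apply: open_comp oker2 => u _; exact: cvg_snd.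
pose U := f @^-1` (fun s => s \in <<S>>).
have [oU sU] : open U /\ is_subgroup U by exact: (preimage_group <<S>>%G).
have US g : f g \in S -> U g by exact: mem_gen.
have cU := open_subgroup_closed sU oU.
have Ux : U (x, z) by apply: US; rewrite !finset.inE eqxx.
have Uy : U (y, w) by apply: US; rewrite !finset.inE eqxx !orbT.
have Ua : U a by apply: US; rewrite !finset.inE eqxx !orbT.
have Uxp : U (x ^+ p, 1) by apply: US; rewrite !finset.inE eqxx !orbT.
have [C1 CM CV] := closed_commutator_subgroup U.
have Cap : closed_commutator U (a ^+ p).
  (* Trivial in the finite quotient but possibly not in G; what counts is that it is a commutator of
     elements of U. *)
  have b_comm : (([~ x ^+ p, y], 1) : G1 * G2) = [~ (x ^+ p, 1), (y, w)].
    have -> : [~ ((x ^+ p, 1) : G1 * G2), (y, w)] = ([~ x ^+ p, y], [~ 1, w]) by [].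
    by rewrite comm1g.
  rewrite -(mulKVg ([~ x ^+ p, y], 1) (a ^+ p)); apply: CM.
    by rewrite b_comm; exact: closed_commutator_comm.
  exact: commXg_mod_commutator Ux Ua.
have : closed_commutator U a by apply: (atf U cU sU a p Ua (prime_gt0 p_pr) Cap).
have [oR sR] := preimage_group (<<S>>^`(1))%G fM oker.
move=> /(closed_commutator_min (open_subgroup_closed sR oR) sR).
have UR u v : U u -> U v -> f [~ u, v] \in <<S>>^`(1).
  by move=> Uu Uv; rewrite morph_mulgR //; exact: mem_commg.
(* Now f a = c^i. The second coordinate 1 forces p to divide i, as [z, w] has order p there; then
   the first coordinate makes the image of [x, y] trivial. *)
move=> /(_ UR) /(fintype.subsetP SR)/cycleP[i].
rewrite -fX expg_pairE /= => -[ti si].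
have si1 : f2 [~ z, w] ^+ i = 1 by rewrite -morph_mulgX // -si morph_mulg1.
have pi : (p %| i)%N.
  have /prime_nt_dvdP <- // : (#[f2 [~ z, w]] %| p)%N by rewrite order_dvdn sp.
    by rewrite order_dvdn si1.
  by rewrite order_eq1; apply/eqP.
case/dvdnP: pi => k ik; apply: t1.
by rewrite ti morph_mulgX // ik mulnC expgnA tp expg1n.
Qed.

End TwoNonabelianFactors.

Lemma one_smooth_character_lifting (p : nat) (G : topologicalGroupType)
    (theta : G -> padic p) :
  (0 < p)%N -> (forall g, theta g = 1) -> one_smooth theta -> character_lifting p G.
Proof.
move=> p_gt0 theta1 smooth U n c oU sU [cM c0].
have theta_p g : exists z, theta g = 1 + z *+ p by exists 0; rewrite mul0rn addr0.
have [C [CM Cc C0]] := one_smooth_lift p_gt0 n smooth theta_p oU sU cM c0.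
exists C => //; split; last exact: C0.
move=> x y Ux Uy.
have : ((p ^ n.+1)%N %| digits (theta x) n.+1 * C y - C y)%Z.
  by rewrite theta1 -[X in _ - X]mul1r -mulrBl dvdz_mulr // dvdz_modB.
by move=> /(rpredD (CM x y Ux Uy)); congr (_ %| _)%Z; ring.
Qed.

(** * The orientation of a product *)

Section Orientation.
Variables (p : nat) (G1 G2 : topologicalGroupType) (theta : (G1 * G2)%type -> padic p).
Hypotheses (p_pr : prime p) (proG1 : is_pro_p G1 p) (proG2 : is_pro_p G2 p).
Hypotheses (smooth : one_smooth theta) (theta_p : forall g, exists z, theta g = 1 + z *+ p).

Lemma finite_p_quotient_comp (G K : topologicalGroupType) (F : finGroupType)
    (f : K -> F) (q : G -> K) :
  {morph q : x y / (x * y)%g} -> (forall y, exists x, q x = y) -> continuous q ->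
  finite_p_quotient p f -> finite_p_quotient p (f \o q).
Proof.
move=> qM q_surj qc [fM f_surj pF oker]; split=> //.
- by move=> x y /=; rewrite qM fM.
- by move=> s; have [y <-] := f_surj s; have [x <-] := q_surj y; exists x.
- by apply: open_comp oker => x _; exact: qc.
Qed.

(** The two quotients required by the descent come from the projections: one through G2 kills (x, 1)
    and not (1, y), one through G1 does the opposite. *)
Lemma orientation_factors x y : x != 1%g -> y != 1%g ->
  theta (x, 1%g) = 1 /\ theta (1%g, y) = 1.
Proof.
move=> x1 y1; have [F1 [f1 [f1q f1x]]] := pro_p_separate_points p_pr proG1 x1.
have [F2 [f2 [f2q f2y]]] := pro_p_separate_points p_pr proG2 y1.
have q1 : finite_p_quotient p (f1 \o @fst G1 G2).
  by apply: finite_p_quotient_comp => // [u|u]; [exists (u, 1%g)|exact: cvg_fst].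
have q2 : finite_p_quotient p (f2 \o @snd G1 G2).
  by apply: finite_p_quotient_comp => // [u|u]; [exists (1%g, u)|exact: cvg_snd].
apply: (commuting_descent p_pr smooth theta_p q2 q1) => //=.
- by rewrite /commute !mulg_pairE /= !mulg1 !mul1g.
- by case: f2q => fM _ _ _; exact: morph_mulg1.
- by case: f1q => fM _ _ _; exact: morph_mulg1.
Qed.

Lemma orientation_trivial : nontrivial_group G1 -> nontrivial_group G2 ->
  (forall g h, theta (g * h)%g = theta g * theta h) -> forall g, theta g = 1.
Proof.
move=> [x x1] [y y1] thetaM.
(* Multiplicativity into the monoid of p-adic integers does not give this at once; 1 is split as (x,
   1) times its inverse, where [orientation_factors] applies. *)
have theta1 : theta 1%g = 1.
  have -> : (1%g : G1 * G2) = ((x, 1) * (x^-1, 1))%g by rewrite mulg_pairE /= mulgV mulg1.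
  rewrite thetaM (orientation_factors x1 y1).1 (orientation_factors _ y1).1 ?mulr1 //.
  by rewrite invg_eq1.
case=> u v; have -> : (u, v) = ((u, 1) * (1, v))%g by rewrite mulg_pairE /= mulg1 mul1g.
rewrite thetaM.
have -> : theta (u, 1%g) = 1.
  by have [->|u1] := eqVneq u 1%g; [exact: theta1|exact: (orientation_factors u1 y1).1].
have -> : theta (1%g, v) = 1.
  by have [->|v1] := eqVneq v 1%g; [exact: theta1|exact: (orientation_factors x1 v1).2].
by rewrite mulr1.
Qed.

End Orientation.

Lemma trivial_orientation_smooth (p : nat) (G : topologicalGroupType) :
  prime p -> is_pro_p G p -> absolutely_torsion_free G ->
  exists theta : G -> padic p,
    [/\ cyclotomic_pair theta, p = 2%N -> image_in_1_4Zp theta & one_smooth theta].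
Proof.
move=> p_pr proG atf; exists (fun=> 1); split.
- split=> //; [exact: cst_continuous|by move=> g h; rewrite mulr1|].
  by move=> g; exists 0; rewrite mul0rn addr0.
- by move=> _ g; exists 0; rewrite mul0rn addr0.
apply: lift_one_smooth => // [|U n c oU sU cM c0]; first exact: prime_gt0.
have [C [CM C0] Cc] := absolutely_torsion_free_lifting p_pr proG atf n oU sU (conj cM c0).
by exists C.
Qed.

Unset Implicit Arguments.

Theorem corollary1p3 (p : nat) (G1 G2 : topologicalGroupType)
    (p_prime : prime p)
    (G1_pro_p : is_pro_p G1 p) (G2_pro_p : is_pro_p G2 p)
    (G1_nontrivial : nontrivial_group G1) (G2_nontrivial : nontrivial_group G2) :
  ((exists theta : (G1 * G2)%type -> padic p,
      [/\ cyclotomic_pair theta, p = 2%N -> image_in_1_4Zp theta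
        & one_smooth theta])
   <->
   ((torsion_free_abelian G1 /\ absolutely_torsion_free G2) \/
    (torsion_free_abelian G2 /\ absolutely_torsion_free G1)))
  /\
  (forall theta : (G1 * G2)%type -> padic p,
      cyclotomic_pair theta -> (p = 2%N -> image_in_1_4Zp theta) ->
      one_smooth theta ->
    forall g, theta g = 1%R).
Proof.
have theta1 (theta : (G1 * G2)%type -> padic p) :
    cyclotomic_pair theta -> one_smooth theta -> forall g, theta g = 1%R.
  by move=> [_ _ thetaM theta_p] smooth; exact: orientation_trivial.
split; last by move=> theta cyc _; exact: theta1.
have proG := pro_p_prod p_prime G1_pro_p G2_pro_p.
have [cG _ _ _] := proG.
have [c1 h1 _ _] := G1_pro_p; have [c2 h2 _ _] := G2_pro_p.
have fst_c : continuous (@fst G1 G2) by move=> u; exact: cvg_fst.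
have snd_c : continuous (@snd G1 G2) by move=> u; exact: cvg_snd.
split=> [[theta [cyc _ smooth]]|].
  have lift := one_smooth_character_lifting (prime_gt0 p_prime) (theta1 theta cyc smooth) smooth.
  have atf := lifting_absolutely_torsion_free p_prime proG lift.
  have [_ hG _ _] := proG.
  have atf1 : absolutely_torsion_free G1.
    apply: (@absolutely_torsion_free_retract G1 (G1 * G2)%type (fun x => (x, 1%g)) fst) => //.
    - by move=> u; apply: cvg_pair; [exact: cvg_id|exact: cvg_cst].
    - by move=> u v; rewrite mulg_pairE /= mulg1.
  have atf2 : absolutely_torsion_free G2.
    apply: (@absolutely_torsion_free_retract G2 (G1 * G2)%type (fun x => (1%g, x)) snd) => //.
    - by move=> u; apply: cvg_pair; [exact: cvg_cst|exact: cvg_id].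
    - by move=> u v; rewrite mulg_pairE /= mulg1.
  have [G1C|G2C] := product_commutative p_prime G1_pro_p G2_pro_p atf; [left|right];
    by split=> //; exact: commutative_torsion_free.
move=> h; apply: trivial_orientation_smooth => //; case: h => [] [tfa atf].
- by apply: (absolutely_torsion_free_prod fst_c snd_c _ _ _ cG h1 h2 tfa atf) => //
     -[? ?] [? ?] /= -> ->.
- by apply: (absolutely_torsion_free_prod snd_c fst_c _ _ _ cG h2 h1 tfa atf) => //
     -[? ?] [? ?] /= -> ->.
Qed.
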